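(* Let $n\ge 2$, $k\ge1$. The coefficient of symmetry of $\overline C$ with respect to $r^{2k}=(x_1^2+\dots+x_n^2)^k$ is \[ \frac{1}{D(n,k)-1}=\frac{1}{\binom{n+k-1}{k}-1}. \]
   Context: $P_{n,2k}$ is the space of real forms of degree $2k$ in $n$ variables, $\sigma$ the rotation-invariant probability measure on $S^{n-1}$, $M=\{f\in P_{n,2k}:\int_{S^{n-1}}f\,d\sigma=1\}$, $C$ the cone of forms nonnegative on $\mathbb R^n$, $\overline C=C\cap M$. $D(n,k)=\binom{n+k-1}{k}$. The coefficient of symmetry of a convex body $K$ about an interior point $v$ is the largest $\beta$ with $-\beta(K-v)\subseteq K-v$. *)

(* Defs.v *)
From HB Require Import structures.
From mathcomp Require Import all_boot all_order all_algebra.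
From mathcomp Require mpoly.

Set Implicit Arguments.
Unset Strict Implicit.
Unset Printing Implicit Defensive.

Module MP.
Import Order.TTheory GRing.Theory Num.Theory.
Import mpoly.
Local Open Scope ring_scope.

Notation poly_n R n := (mpoly.mpoly n R).

Definition is_form (R : numDomainType) (n d : nat) (p : {mpoly R[n]}) : Prop :=
  p \is d.-homog.

Definition ev (R : numDomainType) (n : nat) (p : {mpoly R[n]}) (x : 'I_n -> R) : R :=
  p.@[x].

Definition r2k (R : numDomainType) (n k : nat) : {mpoly R[n]} :=
  (\sum_(i < n) 'X_i ^+ 2) ^+ k.

Definition sym_incl (R : numDomainType) (n : nat) (K : {mpoly R[n]} -> Prop)
    (v : {mpoly R[n]}) (b : R) : Prop :=
  forall f, K f -> exists2 g, K g & - b *: (f - v) = g - v.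

Definition coeff_of_symmetry (R : numDomainType) (n : nat)
    (K : {mpoly R[n]} -> Prop) (v : {mpoly R[n]}) (b : R) : Prop :=
  sym_incl K v b /\ (forall b', sym_incl K v b' -> b' <= b).
End MP.

Notation poly_n R n := (mpoly.mpoly n R).
Definition is_form := MP.is_form.
Definition ev := MP.ev.
Definition r2k := MP.r2k.
Definition coeff_of_symmetry := MP.coeff_of_symmetry.

From mathcomp Require Import all_classical all_reals all_analysis.

Import Order.TTheory GRing.Theory Num.Theory.
Local Open Scope ring_scope.
Local Open Scope classical_set_scope.

(* Lebesgue integral over R^m written as an iterated integral of one-dimensional
   Lebesgue integrals (Fubini); points are functions nat -> R, and the
   coordinates 0..m-1 are integrated. *)
Fixpoint iter_int (R : realType) (m : nat) (g : (nat -> R) -> R) : R :=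
  match m with
  | 0 => g (fun _ => 0)
  | m'.+1 => Rintegral (@lebesgue_measure R) setT
               (fun t => iter_int m' (fun v => g (fun i => if i == m' then t else v i)))
  end.

Definition enorm (R : realType) (n : nat) (v : nat -> R) : R :=
  Num.sqrt (\sum_(i < n) v i ^+ 2).

(* Integral of g over S^{n-1} w.r.t. the rotation-invariant probability measure
   sigma, realised as the cone measure: sigma is the push-forward of the
   normalised Lebesgue measure on the closed unit ball B under x |-> x/|x|, so
   int_S g dsigma = (1/vol B) int_B g(x/|x|) dx. *)
Definition sphere_int (R : realType) (n : nat) (g : ('I_n -> R) -> R) : R :=
  iter_int n (fun v => if enorm n v <= 1
                       then g (fun i : 'I_n => v i / enorm n v) else 0)
  / iter_int n (fun v => if enorm n v <= 1 then 1 else 0).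

Definition Cbar (R : realType) (n k : nat) : poly_n R n -> Prop :=
  fun f => is_form (2 * k) f /\ (forall x, 0 <= ev f x)
           /\ sphere_int (fun x => ev f x) = 1.

(* Main.v *)
(* With D = binomial(n+k-1, k), the claim amounts to: a nonnegative form f of
   degree 2k satisfies f(v) <= D |v|^(2k) (mean of f), and D cannot be improved.

   Write x = (x_0, y).  For fixed y, the polynomial q(u) = f(|y|, u y) is
   nonnegative, hence a sum of two squares a^2 + b^2 with deg a, deg b <= k.
   Let J(q) be the mean of the form x_0^(2k) q(|y| / x_0) (odd powers of u
   dropped).  The Gegenbauer polynomial C_k^(n/2), which is the sum of the zonal
   harmonics of degrees k, k-2, ..., gives a kernel K with J(a K) = a(0) for
   deg a <= k and K(0) = D; by Cauchy-Schwarz a(0)^2 <= D J(a^2), so that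
   |y|^(2k) f(e_0) = q(0) <= D J(q).  Taking means over y gives the bound at the
   pole e_0, and rotations carry it to every point.  Equality holds for the
   square of the zonal form attached to C_k^(n/2).

   About the mean only linearity, positivity and rotation invariance are used.
   The moments come from the infinitesimal rotations x_i d_j - x_j d_i, whose
   images have mean zero.  For the cone measure, rotation invariance holds
   because a plane rotation is a product of three shears, and shears preserve an
   iterated Lebesgue integral by Fubini and translation invariance. *)
Require Import Defs.
From HB Require Import structures.
From mathcomp Require Import all_boot all_order all_algebra.
From mathcomp Require Import ring lra zify.
From mathcomp Require complex polyrcf mpoly.
From mathcomp Require boolp reals all_classical all_reals all_analysis measurable_realfun.

(** * Nonnegative univariate polynomials *)

Module SumOfTwoSquares.
Set Implicit Arguments.
Unset Strict Implicit.
Unset Printing Implicit Defensive.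
Import Order.TTheory GRing.Theory Num.Theory.
Import complex.
Local Open Scope ring_scope.

Section S.
Variable R : rcfType.
Implicit Types (p q a b : {poly R}) (x y : R).

(** By continuity a negative value at [x] persists nearby, and one of the [size s + 1] distinct
    points [x + d / (i + 2)] avoids [s]. *)
Lemma horner_ge0_of_punctured p (s : seq R) :
  (forall x, x \notin s -> 0 <= p.[x]) -> forall x, 0 <= p.[x].
Proof.
move=> p_ge0 x; rewrite leNgt; apply/negP => px_lt0.
have [d d_gt0 dP] := polyrcf.poly_cont x p (e := - p.[x]) ltac:(by rewrite oppr_gt0).
pose t i : R := x + d / i.+2%:R.
have tinj : injective t.
  move=> i j /addrI /(mulfI (lt0r_neq0 d_gt0)) /invr_inj /eqP.
  by rewrite eqr_nat => /eqP[].
have /allPn[y] : ~~ all (mem s) (map t (iota 0 (size s).+1)).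
  apply/negP => /allP sub.
  have u : uniq (map t (iota 0 (size s).+1)) by rewrite map_inj_uniq// iota_uniq.
  by have := uniq_leq_size u sub; rewrite size_map size_iota ltnn.
move=> /mapP[i _ ->] /p_ge0.
have -> : t i = x + d / i.+2%:R by [].
have /dP : `|x + d / i.+2%:R - x| < d.
  rewrite addrC addKr ger0_norm ?divr_ge0 ?ler0n ?(ltW d_gt0)//.
  by rewrite ltr_pdivrMr ?ltr0n// ltr_pMr// ltr1n.
by rewrite ltr_norml => /andP[_]; lra.
Qed.

(** Here x + iy is a complex root of [p]. If y is nonzero, the remainder modulo the quadratic is
    affine with a nonreal root, hence zero. If y = 0, nonnegativity makes the real root at least
    double. *)
Lemma nonneg_poly_factor p : (1 < size p)%N -> (forall x, 0 <= p.[x]) ->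
  exists x y, ('X - x%:P) ^+ 2 + (y ^+ 2)%:P %| p.
Proof.
move=> szp p_ge0.
have [z] : exists z : R[i], root (map_poly (real_complex R) p) z.
  by apply/closed_rootP; rewrite size_map_poly gtn_eqF.
case: z => x y rz; exists x, y.
set d := _ + _ : {poly R}.
have szd : size d = 3%N.
  by rewrite size_polyDl ?size_exp_XsubC// size_polyC; case: (_ != _).
have d0 : d != 0 by rewrite -size_poly_gt0 szd.
have szr : (size (p %% d)%R <= 2)%N by rewrite -ltnS -szd ltn_modp.
have rd : (map_poly (real_complex R) d).[(x +i* y)%C] = 0.
  rewrite rmorphD rmorphXn/= rmorphB/= map_polyX !map_polyC/= !hornerE.
  by rewrite /=; simpc; apply/eqP; rewrite eq_complex/=; apply/andP; split; apply/eqP; ring.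
have : (map_poly (real_complex R) (p %% d)).[(x +i* y)%C] = 0.
  move/rootP: rz; rewrite {1}(divp_eq p d) rmorphD rmorphM/= hornerD hornerM rd.
  by rewrite mulr0 add0r.
move: (divp_eq p d) szr; set r := p %% d => ep szr.
have er : r = (r`_1)%:P * 'X + (r`_0)%:P.
  apply/polyP => -[|[|i]]; rewrite coefD coefMX !coefC//= ?add0r ?addr0//.
  by rewrite nth_default// (leq_trans szr).
rewrite er rmorphD rmorphM/= map_polyX !map_polyC/= !hornerE /=.
simpc => -[e1 /eqP]; rewrite mulf_eq0 => /orP[/eqP r1|/eqP y0].
  move: e1; rewrite r1 mul0r add0r => r0.
  by rewrite /dvdp -/r er r1 r0 mul0r add0r.
have rx : root p x.
  have dx : d.[x] = 0 by rewrite /d y0 expr0n addr0 !hornerE subrr expr0n.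
  by rewrite ep rootE hornerD hornerM dx mulr0 add0r er hornerD hornerM !hornerC hornerX; apply/eqP.
have := rx; rewrite -dvdp_XsubCl => /divpK pE; set p1 := _ %/ _ in pE.
suff : root p1 x.
  rewrite -dvdp_XsubCl => /divpK p1E.
  by rewrite /d y0 expr0n addr0 -pE -p1E -mulrA -expr2 dvdp_mulIr.
have P1 z : 0 <= (p1 * ('X - x%:P)).[z] by rewrite pE.
have s1 z : z != x -> 0 <= (('X - x%:P) * p1).[z] by rewrite mulrC P1.
(* Were [p1] nonzero at [x], its product with ['X - x%:P] would change sign there; a point at
   distance [e / 2] on the proper side shows it. *)
rewrite rootE; apply/eqP/le_anti/andP; split; rewrite leNgt; apply/negP => p1x.
- have [e e_gt0 eP] := polyrcf.poly_cont x p1 p1x.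
  have /eP : `|x + - (e / 2) - x| < e.
    by rewrite addrC addKr normrN ger0_norm; lra.
  have := P1 (x + - (e / 2)); rewrite !hornerE ltr_norml => + /andP[+ _].
  by nra.
- have := p1x; rewrite -oppr_gt0 => np1x.
  have [e e_gt0 eP] := polyrcf.poly_cont x p1 np1x.
  have /eP : `|x + (e / 2) - x| < e.
    by rewrite addrC addKr ger0_norm; lra.
  have := P1 (x + (e / 2)); rewrite !hornerE ltr_norml => + /andP[_ +].
  by nra.
Qed.

(** Induction on the half-degree: each step splits off a quadratic factor that is itself a sum of
    two squares. *)
Lemma nonneg_poly_sum_two_squares k p : (size p <= k.*2.+1)%N ->
  (forall x, 0 <= p.[x]) ->
  exists a b, [/\ (size a <= k.+1)%N, (size b <= k.+1)%N & p = a ^+ 2 + b ^+ 2].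
Proof.
elim: k p => [|k IHk] p szp p_ge0.
  have [c pE] : exists c, p = c%:P by exists p`_0; apply: size1_polyC.
  exists (Num.sqrt c)%:P, 0; split; rewrite ?size_polyC ?size_poly0 ?leq_b1//.
  rewrite expr0n addr0 -rmorphXn/= sqr_sqrtr//.
  by have := p_ge0 0; rewrite pE hornerC.
case: (leqP (size p) 1) => [szp1|szp1].
  have [|a [b [sa sb ->]]] := IHk p _ p_ge0; first exact: leq_trans szp1 _.
  by exists a, b; split=> //; apply: leqW.
have [x [y /dvdpP[p1 pE]]] := nonneg_poly_factor szp1 p_ge0.
set d := _ + _ in pE.
have szd : size d = 3%N.
  by rewrite size_polyDl ?size_exp_XsubC// size_polyC; case: (_ != _).
have d0 : d != 0 by rewrite -size_poly_gt0 szd.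
have p0 : p != 0 by rewrite -size_poly_gt0 (ltn_trans _ szp1).
have p10 : p1 != 0 by apply: contraNneq p0 => p1E; rewrite pE p1E mul0r.
have [||a [b [sa sb p1E]]] := IHk p1.
- move: szp; rewrite pE size_mul// szd addn3/= doubleS; exact.
(* The divisor [d] is positive except possibly at [x]. *)
- apply: (@horner_ge0_of_punctured _ [:: x]) => z; rewrite inE => zx.
  have := p_ge0 z; rewrite pE hornerM pmulr_lge0// /d !hornerE.
  by rewrite ltr_wpDr ?sqr_ge0// exprn_even_gt0//= subr_eq0.
(* The Brahmagupta-Fibonacci identity for a product of two sums of two squares. *)
exists (a * ('X - x%:P) - y *: b), (b * ('X - x%:P) + y *: a).
have szmul q (u : {poly R}) : (size q <= k.+1)%N -> (size u <= k.+1)%N ->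
    (size (q * ('X - x%:P) + y *: u)%R <= k.+2)%N.
  move=> sq su; apply: leq_trans (size_polyD _ _) _; rewrite geq_max; apply/andP; split.
    by apply: leq_trans (size_polyMleq _ _) _; rewrite size_XsubC addn2.
  by apply: leq_trans (size_scale_leq _ _) _; apply: leqW.
split; [rewrite -scalerN; apply: szmul => //; by rewrite size_polyN|exact: szmul|].
by rewrite pE p1E /d -!mul_polyC rmorphXn/=; ring.
Qed.

End S.
End SumOfTwoSquares.

(** * Gegenbauer coefficients *)

Module Gegenbauer.
Set Implicit Arguments.
Unset Strict Implicit.
Unset Printing Implicit Defensive.
Import Order.TTheory GRing.Theory Num.Theory.
Local Open Scope ring_scope.

Section G.
Variable R : numFieldType.
Implicit Types (l : R) (w : nat -> R).

Definition risefac l m : R := \prod_(i < m) (l + i%:R).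

Lemma risefacS l m : risefac l m.+1 = risefac l m * (l + m%:R).
Proof. by rewrite /risefac big_ord_recr. Qed.

Lemma risefac0 l : risefac l 0 = 1.
Proof. by rewrite /risefac big_ord0. Qed.

Lemma risefac_neq0 l m : 0 < l -> risefac l m != 0.
Proof.
move=> l_gt0; apply/prodf_neq0 => i _; apply: lt0r_neq0.
by rewrite ltr_wpDr// ler0n.
Qed.

(* The coefficient of [X ^ (k - 2 j)] in the Gegenbauer polynomial [C_k^(l)]. *)
Definition gcoef l k j : R :=
  if (j.*2 <= k)%N then
    (-1) ^+ j * risefac l (k - j) * 2 ^+ (k - j.*2) / (j`!%:R * (k - j.*2)`!%:R)
  else 0.

Lemma factS_neq0 m : (m`!%:R : R) != 0.
Proof. by rewrite pnatr_eq0 -lt0n fact_gt0. Qed.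

(** Together with [gcoef_recS], this is the recurrence (k+2) C_{k+2} = 2 (k+1+l) X C_{k+1} - (k+2l)
    C_k, read coefficient by coefficient; C_k does not reach the leading term. *)
Lemma gcoef_rec0 l k :
  k.+2%:R * gcoef l k.+2 0 = 2 * (k.+1%:R + l) * gcoef l k.+1 0.
Proof.
rewrite /gcoef /= !subn0 (risefacS _ k.+1) [in LHS]factS natrM exprS.
by field; rewrite !factS_neq0 -(natrD R 2 k) pnatr_eq0.
Qed.

Lemma gcoef_recS l k j :
  k.+2%:R * gcoef l k.+2 j.+1 =
  2 * (k.+1%:R + l) * gcoef l k.+1 j.+1 - (k%:R + 2 * l) * gcoef l k j.
Proof.
rewrite /gcoef; case: (leqP j.*2 k) => [jk|kj]; last first.
  by rewrite !ifF ?mulr0 ?subr0//; lia.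
have [d ->] : exists d, k = (j.*2 + d)%N by exists (k - j.*2)%N; lia.
have -> : ((j.*2 + d).+2 - j.+1 = (j + d).+1)%N by lia.
have -> : ((j.*2 + d).+2 - j.+1.*2 = d)%N by lia.
have -> : ((j.*2 + d) - j = j + d)%N by lia.
have -> : ((j.*2 + d) - j.*2 = d)%N by lia.
rewrite ifT; last by lia.
rewrite risefacS factS natrM exprS.
case: d => [|d].
  (* Here k = 2j: the coefficient is the constant term of C_{k+2}, to which X C_{k+1} contributes
     nothing. *)
  rewrite addn0 ifF; last by lia.
  by rewrite -muln2; field; rewrite !factS_neq0 -(natrD R 1 j) pnatr_eq0.
rewrite ifT; last by lia.
have -> : ((j.*2 + d.+1).+1 - j.+1 = (j + d.+1))%N by lia.
have -> : ((j.*2 + d.+1).+1 - j.+1.*2 = d)%N by lia.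
rewrite factS natrM exprS.
by rewrite -muln2; field; rewrite !factS_neq0 -(natrD R 1 j) -(natrD R 1 d) !pnatr_eq0.
Qed.

(** For k <= 2p, the value at X^(2p-k) C_k^(l) of the linear functional sending X^(2m) to [w m]; the
    terms with 2j > k vanish through [gcoef]. *)
Definition gsum l w k p : R := \sum_(j < k.+1) gcoef l k j * w (p - j)%N.

Lemma gsum_widen l w k p b : (k < b)%N ->
  gsum l w k p = \sum_(j < b) gcoef l k j * w (p - j)%N.
Proof.
move=> kb; rewrite /gsum -(big_mkord xpredT (fun j => gcoef l k j * w (p - j)%N)).
rewrite -[in RHS](big_mkord xpredT (fun j => gcoef l k j * w (p - j)%N)).
rewrite [RHS](big_cat_nat (leq0n _) kb) /= [X in _ = _ + X]big_nat_cond.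
rewrite [X in _ = _ + X]big1 ?addr0//.
by move=> j /andP[/andP[kj _] _]; rewrite /gcoef ifF ?mul0r//; lia.
Qed.

(** The three-term recurrence multiplied by X^(2p-k-2): the factor X in front of C_{k+1} keeps [p],
    while C_k is left with [p.-1]. *)
Lemma gsum_rec l w k p :
  k.+2%:R * gsum l w k.+2 p =
  2 * (k.+1%:R + l) * gsum l w k.+1 p - (k%:R + 2 * l) * gsum l w k p.-1.
Proof.
rewrite (gsum_widen l w p (ltnSn k.+2)) (gsum_widen l w p (leqnSn k.+2)).
rewrite (gsum_widen l w p.-1 (leqnSn k.+1)).
rewrite big_ord_recl [in RHS]big_ord_recl /= [in LHS]mulrDr mulrA gcoef_rec0.
rewrite [X in _ = X - _]mulrDr -addrA; congr (_ + _); first by rewrite -mulrA.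
rewrite !mulr_sumr -sumrB; apply: eq_bigr => j _.
(* For p = 0 truncated subtraction sends every index to 0, so the identity persists. *)
rewrite /bump leq0n add1n mulrA gcoef_recS; case: p => [|p]; last by rewrite subSS; ring.
by rewrite sub0n/=; ring.
Qed.

(** With all weights 1 the sum is C_k^(l)(1), which the recurrence determines from its first two
    values. *)
Lemma gsum_unique l w k (f : nat -> R) :
  f 0%N = 1 -> f 1%N = 2 * l ->
  (forall i, i.+2%:R * f i.+2 = 2 * (i.+1%:R + l) * f i.+1 - (i%:R + 2 * l) * f i) ->
  (forall i, w i = 1) -> gsum l w k k = f k.
Proof.
move=> f0 f1 fS w1.
have W p q k' : gsum l w k' p = gsum l w k' q.
  by apply: eq_bigr => j _; rewrite !w1.
suff : gsum l w k k = f k /\ gsum l w k.+1 k.+1 = f k.+1 by case.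
elim: k => [|k [IH0 IH1]].
  rewrite /gsum /gcoef !big_ord_recr !big_ord0 /= !w1 f0 f1 subn0.
  rewrite risefacS !risefac0 !expr0 !fact0 factS fact0 !subn0 expr1.
  by split; field.
split=> //; have k0 : (k.+2%:R : R) != 0 by rewrite pnatr_eq0.
apply: (mulfI k0); rewrite gsum_rec fS -IH0 -IH1.
by rewrite (W k.+2 k.+1) (W k.+2.-1 k).
Qed.

(** For l = N/2, the mean of x_0^(2m) over the unit sphere of R^N. *)
Definition moment l m : R := risefac 2^-1 m / risefac l m.

Lemma momentS l m : 0 < l ->
  (m.*2%:R + 2 * l) * moment l m.+1 = m.*2.+1%:R * moment l m.
Proof.
move=> l0; rewrite /moment !risefacS -muln2 -addn1 !(natrD, natrM).
have := risefac_neq0 m l0; have : l + m%:R != 0.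
  by apply: lt0r_neq0; rewrite ltr_wpDr// ler0n.
by move=> a b; field; rewrite a b.
Qed.

(* [gsum l (moment l) k p] is the mean of [X ^ (2 p - k) * C_k^(l)] against the
   ultraspherical weight of parameter [l - 1/2]: the sum [C_k^(l)] of the zonal
   harmonics of degrees k, k-2, ... reproduces the value at 1. *)
Lemma gsum_moment l k p : 0 < l -> (k <= p.*2)%N -> (p <= k)%N ->
  gsum l (moment l) k p = 1.
Proof.
(* On the diagonal the factors [risefac l (m - j)] cancel, leaving the Legendre case l = 1/2 with
   unit weights, whose value at 1 is 1. *)
move=> l_gt0; have diag m : gsum l (moment l) m m = 1.
  rewrite -(@gsum_unique 2^-1 (fun=> 1) m (fun=> 1)) //; last 2 first.
  - by field.
  - by move=> i; rewrite -addn2 -[i.+1]addn1 !natrD; field.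
  apply: eq_bigr => j _; rewrite /gcoef; case: ifP => // jm; last by rewrite !mul0r.
  have a0 := risefac_neq0 (m - j) l_gt0.
  have := factS_neq0 j; have := factS_neq0 (m - j.*2) => f1 f2.
  by rewrite /moment; field; rewrite a0 f1 f2.
elim/ltn_ind: k p => -[|[|k]] IH p kp pk.
- by have -> : p = 0%N by [lia]; exact: diag.
- by have -> : p = 1%N by [lia]; exact: diag.
move: pk; rewrite leq_eqVlt => /orP[/eqP->|pk]; first exact: diag.
have k0 : (k.+2%:R : R) != 0 by rewrite pnatr_eq0.
apply: (mulfI k0); rewrite gsum_rec !IH//; try lia.
(* Since 2 (k+1+l) - (k+2l) = k+2, the recurrence preserves the value 1. *)
by rewrite -addn2 -[k.+1]addn1 !natrD; ring.
Qed.

(** The classical value C_k^(l)(1) = binomial(2l+k-1, k) at l = (n+1)/2. *)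
Lemma gsum_one n k :
  gsum (n.+1%:R / 2) (fun=> 1) k k = 'C(n.+1 + k - 1, k)%:R.
Proof.
rewrite (@gsum_unique _ _ _ (fun k => 'C(n + k, k)%:R)) //.
- by rewrite addSn subSS subn0.
- by rewrite bin0.
- by rewrite bin1 addn1; field.
move=> i; have e1 : (i.+2 * 'C(n + i.+2, i.+2) = (n + i.+2) * 'C(n + i.+1, i.+1))%N.
  by rewrite addnS mul_bin_diag.
have e2 : (i.+1 * 'C(n + i.+1, i.+1) = (n + i.+1) * 'C(n + i, i))%N.
  by rewrite addnS mul_bin_diag.
rewrite -natrM e1.
have -> : i%:R + 2 * (n.+1%:R / 2) = (n + i.+1)%:R :> R.
  by rewrite addnS -addSn natrD; field.
by rewrite -[X in _ - X]natrM -e2 !natrM; set c := 'C(_, _)%:R; field.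
Qed.

End G.
End Gegenbauer.

(** * Rotation-invariant means of polynomials *)

Module SphericalMean.
Set Implicit Arguments.
Unset Strict Implicit.
Unset Printing Implicit Defensive.
Import Order.TTheory GRing.Theory Num.Theory.
Import mpoly Gegenbauer SumOfTwoSquares.
Local Open Scope ring_scope.

Lemma polynomial_eq0 (R : numFieldType) (p : {poly R}) :
  (forall x, p.[x] = 0) -> p = 0.
Proof.
move=> p0; apply: (@roots_geq_poly_eq0 _ p (map (fun i : nat => i%:R) (iota 0 (size p)))).
- by apply/allP => x _; apply/rootP.
- by rewrite map_inj_uniq ?iota_uniq//; move=> i j /eqP; rewrite eqr_nat => /eqP.
- by rewrite size_map size_iota.
Qed.

Lemma mderiv_exp (R : comNzRingType) n (p : {mpoly R[n]}) e i :
  (p ^+ e)^`M(i) = p ^+ e.-1 * p^`M(i) *+ e.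
Proof.
elim: e => [|[|e] IH]; first by rewrite expr0 -mpolyC1 mderivC mulr0n.
  by rewrite expr0 mul1r mulr1n.
by rewrite exprS mderivM IH /= mulrnAr mulrA -exprS [_^`M(i) * _]mulrC -mulrS.
Qed.

Lemma mderivXU (R : comNzRingType) n (l i : 'I_n) :
  'X_l^`M(i) = (l == i)%:R :> {mpoly R[n]}.
Proof.
rewrite mderivX mnm1E; case: eqP => [->|_]; last by rewrite scale0r.
suff -> : (U_(i) - U_(i) = 0)%MM by rewrite mpolyX0 scale1r.
by apply/mnmP => k; rewrite mnmBE subnn mnm0E.
Qed.

Lemma meval_homog (R : comNzRingType) n d (p : {mpoly R[n]}) c x :
  p \is d.-homog -> p.@[fun i => c * x i] = c ^+ d * p.@[x].
Proof.
move=> /dhomogP hp; rewrite !mevalE mulr_sumr; apply: eq_big_seq => m /hp <-.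
rewrite mulrCA; congr (_ * _); rewrite [X in c ^+ X](mdegE m) -prodrXr -big_split/=.
by apply: eq_bigr => i _; rewrite exprMn.
Qed.

Definition rot (R : pzRingType) n (i j : 'I_n) (c s : R) (x : 'I_n -> R) : 'I_n -> R :=
  fun l => if l == i then c * x i - s * x j
           else if l == j then s * x i + c * x j else x l.

(** * Differentiating rotations through the Cayley parametrisation *)

Section CayleyFactor.
Variable A : comNzRingType.
Implicit Types a b : A.

(** The shape of a rotated coordinate once 1 + s^2 is cleared: [e] is -1 for the two coordinates of
    the plane and 1 for the fixed ones. *)
Definition cayley (e a b : A) : {poly A} := (1%:P + e *: 'X ^+ 2) * a%:P + 'X * b%:P.

Lemma cayley0 e a b : (cayley e a b).[0] = a.
Proof.
by rewrite /cayley !(hornerD, hornerM, hornerZ, hornerXn, hornerX, hornerC); ring.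
Qed.

Lemma deriv_cayley0 e a b : (cayley e a b)^`().[0] = b.
Proof.
rewrite /cayley derivD !derivM derivD derivZ !derivC derivX derivXn.
rewrite -?polyC0 -?polyC1.
by rewrite !(hornerD, hornerM, hornerZ, hornerXn, hornerX, hornerC, hornerMn); ring.
Qed.

Lemma horner_cayley e a b s : (cayley e a b).[s] = (1 + e * s ^+ 2) * a + s * b.
Proof. by rewrite /cayley !(hornerD, hornerM, hornerZ, hornerXn, hornerX, hornerC, hornerMn). Qed.

End CayleyFactor.

Section Mean.
Variables (R : rcfType) (n : nat).
Local Notation P := {mpoly R[n.+2]}.
Implicit Types (f g h : P) (x : 'I_n.+2 -> R).

Definition rsq : P := \sum_(i < n.+2) 'X_i ^+ 2.

Variable I : P -> R.
Hypothesis I_linear : forall a (p q : P), I (a *: p + q) = a * I p + I q.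
Hypothesis I_ge0 : forall p : P, (forall x, 0 <= p.@[x]) -> 0 <= I p.
Hypothesis I1 : I 1 = 1.
Hypothesis I_rsq : forall p, I (rsq * p) = I p.
Hypothesis I_rot : forall (i j : 'I_n.+2) c s (p q : P), i != j -> c ^+ 2 + s ^+ 2 = 1 ->
  (forall x, q.@[x] = p.@[rot i j c s x]) -> I q = I p.

Lemma ID p q : I (p + q) = I p + I q.
Proof. by rewrite -[p in LHS]scale1r I_linear mul1r. Qed.

Lemma I0 : I 0 = 0.
Proof. by have /eqP := ID 0 0; rewrite addr0 -subr_eq0 opprD addNKr oppr_eq0 => /eqP. Qed.

Lemma IZ a p : I (a *: p) = a * I p.
Proof. by rewrite -[a *: p]addr0 I_linear I0 addr0. Qed.

Lemma IB p q : I (p - q) = I p - I q.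
Proof. by rewrite ID -scaleN1r IZ mulN1r. Qed.

Lemma Isum (T : Type) (r : seq T) (Q : pred T) (F : T -> P) :
  I (\sum_(i <- r | Q i) F i) = \sum_(i <- r | Q i) I (F i).
Proof. exact: (big_morph I ID I0). Qed.

Lemma meval_cayley (e s : R) p q x :
  ((1 + e%:MP * s%:MP ^+ 2) * p + s%:MP * q).@[x] =
  (1 + e * s ^+ 2) * p.@[x] + s * q.@[x].
Proof. by rewrite mevalD !mevalM mevalD meval1 mevalM expr2 mevalM !mevalC expr2. Qed.

Section Infinitesimal.
Variables (i j : 'I_n.+2).
Hypothesis ij : i != j.

(* The rotation of parameter [s] in the plane (i, j) in the Cayley
   parametrisation, multiplied by [1 + s ^ 2]. *)
Let Y (l : 'I_n.+2) : {poly P} :=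
  if l == i then cayley (-1)%:MP 'X_i (- 'X_j *+ 2)
  else if l == j then cayley (-1)%:MP 'X_j ('X_i *+ 2) else cayley 1%:MP 'X_l 0.

Let D (p : P) : P := ('X_i * p^`M(j) - 'X_j * p^`M(i)) *+ 2.

(** [Q] is a curve of polynomials starting at [p] with velocity [D p]. By the Leibniz rule the
    relation is multiplicative, so checking the variables suffices for all monomials. *)
Let S (Q : {poly P}) p := Q.[0] = p /\ Q^`().[0] = D p.

Let S1 : S 1 1.
Proof.
by split; rewrite ?hornerC// -polyC1 derivC hornerC /D -mpolyC1 !mderivC !mulr0 subr0 mul0rn.
Qed.

Let SM Q1 p1 Q2 p2 : S Q1 p1 -> S Q2 p2 -> S (Q1 * Q2) (p1 * p2).
Proof.
move=> [a1 b1] [a2 b2]; split; first by rewrite hornerM a1 a2.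
rewrite derivM hornerD !hornerM a1 a2 b1 b2 /D !mderivM.
by ring.
Qed.

Let SY l : S (Y l) 'X_l.
Proof.
rewrite /S /Y /D !mderivXU; case: (l =P i) => [->|/eqP li].
  by rewrite (negbTE ij) mulr1 mulr0 sub0r cayley0 deriv_cayley0.
case: (l =P j) => [->|/eqP lj]; rewrite cayley0 deriv_cayley0; split=> //.
  by rewrite mulr1 mulr0 subr0.
by rewrite !mulr0 subr0 mul0rn.
Qed.

Let Q (m : 'X_{1..n.+2}) : {poly P} := \prod_l Y l ^+ m l.

Let SQ m : S (Q m) 'X_[m].
Proof.
rewrite mpolyXE_id; apply: (big_ind2 S S1 SM) => l _.
by elim: (m l) => [|e IH]; [rewrite !expr0|rewrite !exprS; apply: SM].
Qed.

Let I_hornerC (W : {poly P}) s :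
  I W.[s%:MP] = (\poly_(l < size W) I W`_l).[s].
Proof.
rewrite horner_coef Isum horner_poly; apply: eq_bigr => l _.
by rewrite -rmorphXn/= mulrC mul_mpolyC IZ mulrC.
Qed.

Let I_Q m s : I (Q m).[s%:MP] = (1 + s ^+ 2) ^+ mdeg m * I 'X_[m].
Proof.
have s1 : 1 + s ^+ 2 != 0 by rewrite lt0r_neq0// ltr_wpDr ?sqr_ge0.
rewrite -[I 'X_[m]](@I_rot i j ((1 - s ^+ 2) / (1 + s ^+ 2)) (2 * s / (1 + s ^+ 2)) _
  ((1 + s ^+ 2) ^- mdeg m *: (Q m).[s%:MP]) ij); first last.
- move=> x; rewrite mevalZ /Q horner_prod rmorph_prod mevalX mdegE -prodrXr -prodfV -big_split/=.
  apply: eq_bigr => l _; rewrite horner_exp rmorphXn/= -exprVn -exprMn; congr (_ ^+ _).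
  rewrite /rot /Y; case: ifP => _; last case: ifP => _; rewrite horner_cayley.
  + by rewrite meval_cayley mevalMn mevalN !mevalXU; field.
  + by rewrite meval_cayley mevalMn !mevalXU; field.
  + by rewrite meval_cayley meval0 !mevalXU; field.
- by field.
by rewrite IZ mulrA divff ?mul1r// expf_neq0.
Qed.

(** On a monomial, invariance says that the mean along the curve is a constant times a power of 1 +
    s^2. This has no linear term in s, and the linear coefficient is the mean of the derivative. *)
Lemma I_infinitesimal_rot p : I ('X_i * p^`M(j) - 'X_j * p^`M(i)) = 0.
Proof.
rewrite [p]mpolyE !raddf_sum /= !mulr_sumr -sumrB Isum big1// => m _.
rewrite !mderivZ -!scalerAr -scalerBr IZ.
suff : I (D 'X_[m]) = 0.
  by rewrite /D mulr2n ID -mulr2n => /eqP; rewrite mulrn_eq0 => /eqP->; rewrite mulr0.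
have [_ <-] := SQ m; rewrite horner_coef0 coef_deriv mulr1n.
pose W := \poly_(l < size (Q m)) I (Q m)`_l.
have WE : W = I 'X_[m] *: (1 + 'X ^+ 2) ^+ mdeg m.
  apply/eqP; rewrite -subr_eq0; apply/eqP/polynomial_eq0 => s.
  by rewrite hornerD hornerN hornerZ -I_hornerC I_Q horner_exp !hornerE mulrC subrr.
have : W`_1 = I (Q m)`_1.
  rewrite coef_poly; case: ltnP => // le; by rewrite nth_default// I0.
move=> <-; rewrite -[W`_1]mulr1n -coef_deriv WE derivZ -horner_coef0 hornerZ.
rewrite deriv_exp derivD -polyC1 derivC derivXn add0r !(hornerMn, hornerM) hornerXn.
by rewrite expr1 mul0rn mul0r mul0rn mulr0.
Qed.
End Infinitesimal.

(** * Mixed moments in x_0 and y *)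

Local Notation X0 := ('X_ord0 : P).
Local Notation Y j := ('X_(lift ord0 j) : P).

Definition ysq : P := \sum_(j < n.+1) Y j ^+ 2.

Lemma rsqE : rsq = X0 ^+ 2 + ysq.
Proof. by rewrite /rsq big_ord_recl. Qed.

(* Being a form of degree [d] in the variables other than [x_0], by Euler's identity. *)
Definition yform d g := g^`M(ord0) = 0 /\
  \sum_(j < n.+1) Y j * g^`M(lift ord0 j) = g *+ d.

Lemma yform1 : yform 0 1.
Proof.
rewrite /yform -mpolyC1 mderivC; split=> //.
by rewrite big1// => j _; rewrite mderivC mulr0.
Qed.

Lemma yformM d e g h : yform d g -> yform e h -> yform (d + e) (g * h).
Proof.
move=> [g0 gE] [h0 hE]; rewrite /yform mderivM g0 h0 mul0r mulr0 addr0; split=> //.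
rewrite mulrnDr -mulrnAl -gE -mulrnAr -hE mulr_suml mulr_sumr -big_split/=.
apply: eq_bigr => j _; rewrite mderivM mulrDr; congr (_ + _); first exact: mulrA.
exact: mulrCA.
Qed.

Lemma yformX d g e : yform d g -> yform (e * d) (g ^+ e).
Proof.
move=> gd; elim: e => [|e IH]; first by rewrite expr0; exact: yform1.
by rewrite exprS mulSn; exact: yformM.
Qed.

Lemma yform_var j : yform 1 (Y j).
Proof.
rewrite /yform mderivXU; split=> //; rewrite (bigD1 j)//= mderivXU eqxx mulr1.
rewrite big1 ?addr0// => i ij; rewrite mderivXU (inj_eq lift_inj).
by rewrite eq_sym (negbTE ij) mulr0.
Qed.

Lemma yform_ysq : yform 2 ysq.
Proof.
have Y2 j : yform 2 (Y j ^+ 2) by have := yformX 2 (yform_var j).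
rewrite /yform /ysq raddf_sum/= big1; last by move=> j _; case: (Y2 j).
split=> //; under eq_bigr do rewrite raddf_sum/= mulr_sumr.
by rewrite exchange_big -sumrMnl; apply: eq_bigr => j _; case: (Y2 j).
Qed.

Definition ymon (m : 'X_{1..n.+2}) : P := \prod_(j < n.+1) Y j ^+ m (lift ord0 j).

Definition ydeg (m : 'X_{1..n.+2}) : nat := \sum_(j < n.+1) m (lift ord0 j).

Lemma mpolyX_ymon m : 'X_[m] = X0 ^+ m ord0 * ymon m.
Proof. by rewrite mpolyXE_id big_ord_recl. Qed.

Lemma mdeg_ydeg m : mdeg m = (m ord0 + ydeg m)%N.
Proof. by rewrite mdegE big_ord_recl. Qed.

Lemma yform_ymon m : yform (ydeg m) (ymon m).
Proof.
apply: (big_ind2 yform yform1); first by move=> d g e h; exact: yformM.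
by move=> j _; have := yformX (m (lift ord0 j)) (yform_var j); rewrite muln1.
Qed.

(** The field x_0 d_j - y_j d_0 applied to x_0^e y_j g has mean zero; summing over j and using
    Euler's identity gives the factor n + 1 + d. *)
Lemma I_recur d g e : yform d g ->
  (n.+1 + d)%:R * I (X0 ^+ e.+1 * g) = e%:R * I (X0 ^+ e.-1 * (ysq * g)).
Proof.
move=> [g0 gE].
have step j : I (X0 ^+ e.+1 * (g + Y j * g^`M(lift ord0 j))) =
    e%:R * I (X0 ^+ e.-1 * (Y j ^+ 2 * g)).
  rewrite -IZ; apply/eqP; rewrite -subr_eq0 -IB; apply/eqP.
  rewrite -[RHS](I_infinitesimal_rot (neq_lift ord0 j) (X0 ^+ e * (Y j * g))).
  congr I; rewrite !mderivM !mderiv_exp !mderivXU eqxx g0 (negbTE (neq_lift ord0 j)).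
  rewrite eq_sym (negbTE (neq_lift ord0 j)) scaler_nat.
  rewrite !eqxx mulr0n mulr1n !(mulr0, mul0r, mul0rn, add0r, addr0, mul1r, mulr1).
  rewrite mulrnAl mulrnAr exprS.
  congr (_ - _ *+ _); first exact/esym/mulrA. by rewrite expr2 -mulrA mulrCA.
have -> : (n.+1 + d)%:R * I (X0 ^+ e.+1 * g) =
    \sum_(j < n.+1) I (X0 ^+ e.+1 * (g + Y j * g^`M(lift ord0 j))).
  rewrite -Isum -mulr_sumr big_split/= gE sumr_const card_ord -mulrnDr.
  by rewrite mulrnAr -scaler_nat IZ.
rewrite /ysq mulr_suml mulr_sumr Isum mulr_sumr; exact: eq_bigr.
Qed.

(* Moving [x_0 ^ (2 a)] into [|y| ^ (2 a)] multiplies the mean by a constant that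
   depends only on [a] and on the degree in [y]. *)
Lemma I_even_swap d g h a : yform d g -> yform d h ->
  I (X0 ^+ a.*2 * g) * I (ysq ^+ a * h) = I (X0 ^+ a.*2 * h) * I (ysq ^+ a * g).
Proof.
elim: a d g h => [|a IH] d g h gd hd; first by rewrite !expr0 !mul1r mulrC.
have c0 : (n.+1 + d)%:R != 0 :> R by rewrite pnatr_eq0.
apply: (mulfI c0); rewrite !mulrA !doubleS !I_recur// -!mulrA; congr (_ * _).
by rewrite !exprSr -!mulrA; apply: (IH (2 + d)%N); apply: yformM => //; exact: yform_ysq.
Qed.

Lemma I_odd d g a : yform d g -> I (X0 ^+ a.*2.+1 * g) = 0.
Proof.
elim: a d g => [|a IH] d g gd; have c0 : (n.+1 + d)%:R != 0 :> R by rewrite pnatr_eq0.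
  by apply: (mulfI c0); rewrite I_recur// mul0r mulr0.
apply: (mulfI c0); rewrite doubleS I_recur//= (IH (2 + d)%N) ?mulr0//.
by apply: yformM => //; exact: yform_ysq.
Qed.

Local Notation lam := (n.+2%:R / 2 : R).

Lemma lam_gt0 : 0 < lam.
Proof. by rewrite divr_gt0 ?ltr0n. Qed.

Lemma I_X0 a : I (X0 ^+ a.*2) = moment lam a.
Proof.
elim: a => [|a IH]; first by rewrite expr0 I1 /moment !risefac0 divr1.
have c0 : a.*2%:R + 2 * lam != 0.
  by rewrite lt0r_neq0// ltr_wpDl ?ler0n// mulr_gt0 ?lam_gt0.
apply: (mulfI c0); rewrite momentS ?lam_gt0// -IH.
have := @I_recur 0 1 a.*2.+1 yform1; rewrite !mulr1 /= doubleS.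
(* As [rsq] has no effect under the mean, the recurrence closes on the powers of x_0. *)
have -> : ysq = rsq - X0 ^+ 2 by rewrite rsqE addrC addKr.
rewrite mulrBr IB [X0 ^+ _ * rsq]mulrC I_rsq -exprD addn2 addn0.
set s := I _; set t := I _ => e.
have -> : a.*2%:R + 2 * lam = n.+1%:R + a.*2.+1%:R :> R by field.
by rewrite mulrDl e; ring.
Qed.

(** If this mean were zero, [I_recur] would carry the zero step by step to the mean of x_0^(2k),
    which is a nonzero moment. *)
Lemma I_ysq_gt0 k : 0 < I (ysq ^+ k).
Proof.
have ysq_ge0 x : 0 <= ysq.@[x].
  by rewrite /ysq rmorph_sum/= sumr_ge0// => j _; rewrite rmorphXn/= sqr_ge0.
rewrite lt_neqAle I_ge0 ?andbT; last by move=> x; rewrite rmorphXn/= exprn_ge0.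
apply/eqP => /esym e0.
have {}e0 a : (a <= k)%N -> I (X0 ^+ a.*2 * ysq ^+ (k - a)) = 0.
  elim: a => [|a IH ak]; first by rewrite expr0 mul1r subn0.
  have c0 : (n.+1 + (k - a.+1) * 2)%:R != 0 :> R by rewrite pnatr_eq0.
  apply: (mulfI c0); rewrite doubleS I_recur; last exact: yformX yform_ysq.
  by rewrite -exprS subnSK// IH ?mulr0// ltnW.
have := e0 k (leqnn k); rewrite subnn mulr1 I_X0 => /eqP.
by rewrite /moment mulf_eq0 invr_eq0 !(negbTE (risefac_neq0 _ _)) ?lam_gt0// invr_gt0.
Qed.

(** * The mean in the dehomogenized variable and its reproducing kernel *)

Section Dehomogenized.
Variable k : nat.

(* [J q] is the mean of the form of degree [2 k] whose dehomogenization in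
   [u = |y| / x_0] is [q]; odd powers of [u] average out. *)
Definition wt l : P := if odd l then 0 else X0 ^+ (k.*2 - l) * ysq ^+ l./2.

Definition lift_form (q : {poly R}) : P := \sum_(l < k.*2.+1) q`_l *: wt l.

Definition J q := I (lift_form q).

Lemma lift_form_linear a q1 q2 :
  lift_form (a *: q1 + q2) = a *: lift_form q1 + lift_form q2.
Proof.
rewrite /lift_form scaler_sumr -big_split/=; apply: eq_bigr => l _.
by rewrite coefD coefZ scalerDl scalerA.
Qed.

Lemma J_linear a q1 q2 : J (a *: q1 + q2) = a * J q1 + J q2.
Proof. by rewrite /J lift_form_linear I_linear. Qed.

Lemma JD q1 q2 : J (q1 + q2) = J q1 + J q2.
Proof. by rewrite -[q1 in LHS]scale1r J_linear mul1r. Qed.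

Lemma J0 : J 0 = 0.
Proof. by have /eqP := JD 0 0; rewrite addr0 -subr_eq0 opprD addNKr oppr_eq0 => /eqP. Qed.

Lemma JZ a q : J (a *: q) = a * J q.
Proof. by rewrite -[a *: q]addr0 J_linear J0 addr0. Qed.

Lemma Jsum (T : Type) (r : seq T) (Q : pred T) (F : T -> {poly R}) :
  J (\sum_(i <- r | Q i) F i) = \sum_(i <- r | Q i) J (F i).
Proof. exact: (big_morph J JD J0). Qed.

Lemma lift_formX l : (l <= k.*2)%N -> lift_form 'X^l = wt l.
Proof.
move=> lk; rewrite /lift_form (bigD1 (Ordinal (lk : (l < k.*2.+1)%N)))//= coefXn eqxx.
rewrite scale1r big1 ?addr0// => i il; rewrite coefXn.
by rewrite (_ : (i == l :> nat) = false) ?scale0r//; apply/negbTE.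
Qed.

Lemma poly_sum_coef m (a : {poly R}) : (size a <= m.+1)%N ->
  a = \sum_(i < m.+1) a`_i *: 'X^i.
Proof.
move=> sa; rewrite -[LHS](coefK a) poly_def.
rewrite (big_ord_widen m.+1 (fun i : nat => a`_i *: 'X^i) sa) big_mkcond/=.
by apply: eq_bigr => i _; case: ltnP => // /(nth_default _)->; rewrite scale0r.
Qed.

Definition homogenize m (t u : R) (a : {poly R}) : R :=
  \sum_(l < m.+1) a`_l * (t ^+ (m - l) * u ^+ l).

Lemma homogenize_sqr t u (a : {poly R}) : (size a <= k.+1)%N ->
  homogenize k.*2 t u (a ^+ 2) = homogenize k t u a ^+ 2.
Proof.
move=> sa.
have HX l : (l <= k.*2)%N -> homogenize k.*2 t u 'X^l = t ^+ (k.*2 - l) * u ^+ l.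
  move=> lk; rewrite /homogenize (bigD1 (Ordinal (lk : (l < k.*2.+1)%N)))//= coefXn eqxx.
  rewrite mul1r big1 ?addr0// => i il; rewrite coefXn.
  by rewrite (_ : (i == l :> nat) = false) ?mul0r//; apply/negbTE.
have HD : {morph homogenize k.*2 t u : p q / p + q}.
  by move=> p q; rewrite -big_split/=; apply: eq_bigr => l _; rewrite coefD mulrDl.
have H0 : homogenize k.*2 t u 0 = 0.
  by rewrite /homogenize big1// => l _; rewrite coef0 mul0r.
have HZ c p : homogenize k.*2 t u (c *: p) = c * homogenize k.*2 t u p.
  by rewrite /homogenize mulr_sumr; apply: eq_bigr => l _; rewrite coefZ mulrA.
rewrite !expr2 [in LHS](poly_sum_coef sa) mulr_suml (big_morph _ HD H0).
rewrite [RHS]mulr_suml; apply: eq_bigr => i _.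
rewrite !mulr_sumr (big_morph _ HD H0); apply: eq_bigr => j _.
have ij : (i + j <= k.*2)%N by move: (ltn_ord i) (ltn_ord j); lia.
rewrite -scalerAl -scalerAr !HZ -exprD HX//.
have -> : (k.*2 - (i + j) = (k - i) + (k - j))%N.
  by move: (ltn_ord i) (ltn_ord j); lia.
by rewrite !exprD; ring.
Qed.

Lemma meval_ysq_ge0 x : 0 <= ysq.@[x].
Proof. by rewrite /ysq rmorph_sum/= sumr_ge0// => j _; rewrite rmorphXn/= sqr_ge0. Qed.

Lemma meval_wt x l : (wt l).@[x] =
  if odd l then 0 else x ord0 ^+ (k.*2 - l) * ysq.@[x] ^+ l./2.
Proof.
by rewrite /wt; case: ifP => _; rewrite ?meval0// mevalM !rmorphXn/= mevalXU.
Qed.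

(** Dropping odd powers amounts to averaging over u = |y| and u = -|y|, and homogenizing [a ^+ 2]
    gives the square of the homogenized [a]. *)
Lemma J_sqr_ge0 (a : {poly R}) : (size a <= k.+1)%N -> 0 <= J (a ^+ 2).
Proof.
move=> sa; apply: I_ge0 => x; pose u := Num.sqrt ysq.@[x].
rewrite -(pmulr_rge0 _ (ltr0n R 2)).
suff -> : 2 * (lift_form (a ^+ 2)).@[x] =
    homogenize k.*2 (x ord0) u (a ^+ 2) + homogenize k.*2 (x ord0) (- u) (a ^+ 2).
  by rewrite !homogenize_sqr// addr_ge0// sqr_ge0.
rewrite /lift_form rmorph_sum/= mulr_sumr -big_split/=; apply: eq_bigr => l _.
rewrite mevalZ meval_wt; case: ifPn => [ol|el].
  by rewrite exprNn -signr_odd ol expr1; ring.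
rewrite exprNn -signr_odd (negbTE el) expr0 mul1r.
rewrite -[X in u ^+ X](even_halfK el) -[X in u ^+ X]mul2n exprM sqr_sqrtr ?meval_ysq_ge0//.
by ring.
Qed.

(** With u = |y| / x_0, the factor 1 + u^2 is |x|^2 / x_0^2. *)
Lemma lift_form_pow i : (i <= k)%N ->
  lift_form ((1 + 'X^2) ^+ i) = X0 ^+ (k - i).*2 * (X0 ^+ 2 + ysq) ^+ i.
Proof.
move=> ik; rewrite !exprDn_comm; try exact: mulrC.
have LD : {morph lift_form : p q / p + q}.
  by move=> p q; rewrite -[p in LHS]scale1r lift_form_linear scale1r.
have L0 : lift_form 0 = 0.
  by rewrite /lift_form big1// => l _; rewrite coef0 scale0r.
rewrite (big_morph _ LD L0) mulr_sumr; apply: eq_bigr => l _.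
have li : (l <= i)%N by rewrite -ltnS.
rewrite expr1n mul1r -exprM mul2n -scaler_nat.
rewrite -[_ *: _]addr0 lift_form_linear L0 addr0 lift_formX; last by lia.
rewrite scaler_nat mulrnAr /wt odd_double doubleK mulrA -exprM -exprD.
by congr (X0 ^+ _ * _ *+ _); lia.
Qed.

Lemma J_pow i : (i <= k)%N -> J ((1 + 'X^2) ^+ i) = moment lam (k - i).
Proof.
move=> ik; rewrite /J lift_form_pow// -rsqE mulrC -I_X0.
by elim: i {ik} (k - i)%N => [|i IH] m; rewrite ?expr0 ?mul1r// exprS -mulrA I_rsq IH.
Qed.

(** The zonal form |x|^k C_k(x_0 / |x|) divided by x_0^k, as a polynomial in u. *)
Definition kernel : {poly R} := \sum_(j < k.+1) gcoef lam k j *: (1 + 'X^2) ^+ j.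

Lemma J_odd_kernel r : odd r -> J ('X^r * kernel) = 0.
Proof.
move=> or; rewrite /kernel mulr_sumr Jsum big1// => j _.
rewrite -scalerAr JZ exprDn_comm; last exact: mulrC.
rewrite mulr_sumr Jsum big1 ?mulr0// => l _.
rewrite expr1n mul1r -exprM mulrnAr -exprD -scaler_nat JZ.
suff -> : J ('X^(r + 2 * l)) = 0 by rewrite mulr0.
rewrite /J /lift_form Isum big1// => i _; rewrite IZ coefXn.
case: eqP => [->|_]; last by rewrite mul0r.
by rewrite /wt oddD oddM addbF or I0 mulr0.
Qed.

(** By [J_pow] the left side is the Gegenbauer sum of [gsum_moment] at p = k - i, whose range
    condition is 2i <= k. *)
Lemma J_pow_kernel i : (i.*2 <= k)%N -> J ((1 + 'X^2) ^+ i * kernel) = 1.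
Proof.
move=> ik; rewrite -(@gsum_moment R lam k (k - i)) ?lam_gt0//; try lia.
rewrite /kernel mulr_sumr Jsum; apply: eq_bigr => j _.
rewrite -scalerAr JZ /gcoef; case: ifP => jk; last by rewrite !mul0r.
by rewrite -exprD J_pow ?subnDA//; lia.
Qed.

Lemma J_kernel (a : {poly R}) : (size a <= k.+1)%N -> J (a * kernel) = a`_0.
Proof.
move=> sa; rewrite {1}(poly_sum_coef sa) mulr_suml Jsum big_ord_recl/=.
rewrite big1 ?addr0.
  by rewrite -scalerAl JZ (@J_pow_kernel 0)// mulr1.
move=> i _; rewrite /bump leq0n add1n -scalerAl JZ.
have [or|er] := boolP (odd i.+1); first by rewrite J_odd_kernel// mulr0.
have iE := even_halfK er; set s := _./2 in iE.
have s0 : s != 0%N by move: iE; case: s.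
(* Each power of 1 + u^2 pairs to 1 with the kernel, so u^(2s) = ((1 + u^2) - 1)^s pairs to (1 -
   1)^s = 0. *)
rewrite -iE -mul2n exprM (_ : 'X^2 = (1 + 'X^2) + (-1)%:P); last first.
  by rewrite polyCN addrC addKr.
rewrite exprDn_comm; last exact: mulrC.
rewrite mulr_suml Jsum (_ : \sum_i _ = (1 - 1) ^+ s).
  by rewrite subrr expr0n (negbTE s0) mulr0.
rewrite exprDn_comm; last exact: mulrC.
apply: eq_bigr => l _; rewrite expr1n mul1r -rmorphXn/= [X in X *+ _ * _]mulrC mulrnAl mul_polyC.
rewrite -scaler_nat JZ -scalerAl JZ J_pow_kernel; first by rewrite mulr1 mulr_natl.
by move: (ltn_ord l) (ltn_ord i) iE; lia.
Qed.

Local Notation dimk := ('C(n.+2 + k - 1, k)%:R : R).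

Lemma dimk_gt0 : 0 < dimk.
Proof. by rewrite ltr0n bin_gt0; lia. Qed.

Lemma sum_gcoef : \sum_(j < k.+1) gcoef lam k j = dimk.
Proof. by rewrite -gsum_one; apply: eq_bigr => j _; rewrite mulr1. Qed.

Lemma kernel_coef0 : kernel`_0 = dimk.
Proof.
rewrite -sum_gcoef coef_sum; apply: eq_bigr => j _.
by rewrite coefZ -horner_coef0 horner_exp hornerD hornerC hornerXn expr0n addr0 expr1n mulr1.
Qed.

Lemma size_kernel : (size kernel <= k.+1)%N.
Proof.
apply: (leq_trans (size_sum _ _ _)); apply/bigmax_leqP => j _.
rewrite /gcoef; case: ifP => jk; last by rewrite scale0r size_poly0.
apply: (leq_trans (size_scale_leq _ _)); apply: (leq_trans (size_poly_exp_leq _ _)).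
have -> : size (1 + 'X^2 : {poly R}) = 3%N.
  by rewrite addrC size_polyDl size_polyXn// size_poly1.
by rewrite /=; lia.
Qed.

(* Cauchy-Schwarz for the reproducing kernel. *)
Lemma J_sqr_bound (a : {poly R}) : (size a <= k.+1)%N ->
  a`_0 ^+ 2 <= dimk * J (a ^+ 2).
Proof.
(* This [c] minimises the mean of (a - c K)^2. *)
move=> sa; pose c := a`_0 / dimk.
have sz : (size (a - c *: kernel)%R <= k.+1)%N.
  apply: leq_trans (size_polyD _ _) _; rewrite geq_max sa size_polyN.
  exact: leq_trans (size_scale_leq _ _) size_kernel.
have := J_sqr_ge0 sz.
have -> : (a - c *: kernel) ^+ 2 =
    a ^+ 2 + ((- (2 * c)) *: (a * kernel) + c ^+ 2 *: (kernel * kernel)).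
  by rewrite -!mul_polyC !(polyCN, polyCM, rmorphXn)/=; ring.
rewrite !JD !JZ !J_kernel// ?size_kernel// kernel_coef0.
have d0 := dimk_gt0; have dn : dimk != 0 by rewrite lt0r_neq0.
rewrite -(pmulr_rge0 _ d0) => H; rewrite -subr_ge0; apply: le_trans H _.
by rewrite le_eqVlt; apply/orP; left; apply/eqP; rewrite /c; field.
Qed.

Lemma J_nonneg_bound (q : {poly R}) : (size q <= k.*2.+1)%N ->
  (forall u, 0 <= q.[u]) -> q.[0] <= dimk * J q.
Proof.
move=> sq q0; have [a [b [sa sb ->]]] := nonneg_poly_sum_two_squares sq q0.
rewrite hornerD !horner_exp !horner_coef0 JD mulrDr.
by apply: lerD; exact: J_sqr_bound.
Qed.

Lemma J_X l : (l <= k.*2)%N -> J 'X^l = I (wt l).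
Proof. by move=> lk; rewrite /J lift_formX. Qed.

(** * The bound at the pole *)

Section Pole.
Variable f : P.
Hypothesis f_homog : f \is k.*2.-homog.
Hypothesis f_ge0 : forall x, 0 <= f.@[x].

Let mdeg_f m : m \in msupp f -> k.*2 = (m ord0 + ydeg m)%N.
Proof. by move=> mf; rewrite -mdeg_ydeg; apply/esym; have /dhomogP := f_homog; apply. Qed.

(* [u |-> f(|y|, u y)]: scaling the pole by [|y|] makes [J (slice x)] a polynomial in x,
   namely [averaged], whose mean is proportional to that of [f]. *)
Let slice x : {poly R} := \sum_(m <- msupp f)
  (f@_m * (Num.sqrt ysq.@[x] ^+ m ord0 * (ymon m).@[x])) *: 'X^(ydeg m).

Let slice_point x u : 'I_n.+2 -> R :=
  fun l => if l == ord0 then Num.sqrt ysq.@[x] else u * x l.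

Let horner_slice x u : (slice x).[u] = f.@[slice_point x u].
Proof.
rewrite horner_sum [in RHS]mevalE; apply: eq_big_seq => m _.
rewrite hornerZ hornerXn -!mulrA; congr (_ * _); rewrite big_ord_recl /=; congr (_ * _).
rewrite /ymon rmorph_prod/= -prodrXr -big_split/=; apply: eq_bigr => j _.
by rewrite rmorphXn/= mevalXU /slice_point lift_eqF exprMn mulrC.
Qed.

Let size_slice x : (size (slice x) <= k.*2.+1)%N.
Proof.
rewrite /slice big_seq; apply: (big_ind (fun q : {poly R} => size q <= k.*2.+1)%N).
- by rewrite size_poly0.
- by move=> p q sp sq; apply: leq_trans (size_polyD _ _) _; rewrite geq_max sp sq.
- move=> m /mdeg_f ->; apply: leq_trans (size_scale_leq _ _) _.
  by rewrite size_polyXn ltnS leq_addl.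
Qed.

Let averaged : P := \sum_(m <- msupp f)
  (f@_m * I (wt (ydeg m))) *: (ysq ^+ (m ord0)./2 * ymon m).

Let odd_ydeg m : m \in msupp f -> odd (ydeg m) = odd (m ord0).
Proof. by move=> /mdeg_f/(congr1 odd); rewrite odd_double oddD; case: odd; case: odd. Qed.

Let I_averaged : I averaged = I (ysq ^+ k) * I f.
Proof.
rewrite [f in RHS]mpolyE !Isum mulr_sumr; apply: eq_big_seq => m mf.
rewrite !IZ mulrCA -mulrA; congr (_ * _); rewrite mpolyX_ymon /wt odd_ydeg//.
have d2 := mdeg_f mf; case: ifPn => om.
  rewrite I0 mul0r -[m ord0 in RHS](odd_double_half) om add1n.
  by rewrite (I_odd _ (yform_ymon m)) mulr0.
have mE := even_halfK om; set a := _./2 in mE *.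
have yE : (ydeg m)./2.*2 = ydeg m by apply: even_halfK; rewrite odd_ydeg.
set b := _./2 in yE *.
have yb : yform (ydeg m) (ysq ^+ b) by rewrite -yE -muln2; exact: yformX yform_ysq.
rewrite -mE (_ : k.*2 - ydeg m = a.*2)%N; last by lia.
(* [ysq ^+ b] and [ymon m] have the same degree in y, so they can be exchanged; a + b = k then
   yields the common factor [I (ysq ^+ k)]. *)
rewrite (I_even_swap a yb (yform_ymon m)) mulrC; congr (I _ * _).
by rewrite -exprD; congr (_ ^+ _); lia.
Qed.

Let meval_averaged x : averaged.@[x] = J (slice x).
Proof.
rewrite /averaged rmorph_sum/= Jsum; apply: eq_big_seq => m mf.
have d2 := mdeg_f mf; rewrite mevalZ JZ J_X; last by lia.
rewrite -!mulrA; congr (_ * _); rewrite mulrC mulrA.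
have [od|ed] := boolP (odd (ydeg m)); first by rewrite /wt od I0 ?(mulr0, mul0r).
rewrite odd_ydeg// in ed; have mE := even_halfK ed.
rewrite mevalM rmorphXn/= -[m ord0 in RHS]mE -mul2n exprM sqr_sqrtr ?meval_ysq_ge0//.
Qed.

Lemma pole_bound : f.@[fun l => (l == ord0)%:R] <= dimk * I f.
Proof.
set e0 := fun l => _.
suff : 0 <= I (dimk *: averaged - f.@[e0] *: ysq ^+ k).
  by rewrite IB !IZ I_averaged mulrCA [_ * I (ysq ^+ k)]mulrC -mulrBr
    pmulr_rge0 ?I_ysq_gt0// subr_ge0.
apply: I_ge0 => x; rewrite mevalB !mevalZ meval_averaged subr_ge0.
have := @J_nonneg_bound (slice x) (size_slice x).
rewrite !horner_slice => /(_ (fun u => eq_rect_r (fun z => 0 <= z) (f_ge0 _) (horner_slice x u))).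
apply: le_trans; rewrite le_eqVlt; apply/orP; left; apply/eqP.
(* At u = 0 the slice passes through |y| e_0, where homogeneity extracts |y|^(2k). *)
rewrite (@meval_eq _ _ (slice_point x 0) (fun l => Num.sqrt ysq.@[x] * e0 l)); last first.
  move=> l; rewrite /slice_point /e0; case: (eqVneq l ord0) => _; by rewrite ?mulr1 ?mulr0 ?mul0r.
rewrite (meval_homog _ _ f_homog) rmorphXn/= -mul2n exprM sqr_sqrtr ?meval_ysq_ge0//.
by rewrite mulrC.
Qed.

End Pole.

(** * From the pole to all points, and sharpness *)

Lemma var_homog (i : 'I_n.+2) : ('X_i : P) \is 1.-homog.
Proof. by rewrite dhomogX /= mdeg1. Qed.

Lemma exp_homog1 e f : f \is 1.-homog -> f ^+ e \is e.-homog.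
Proof. by move=> fh; have := dhomogMn e fh; rewrite mul1n. Qed.

Definition rot_mpoly i j c s f : P :=
  f \mPo [tuple (if l == i then c *: 'X_i - s *: 'X_j
                 else if l == j then s *: 'X_i + c *: 'X_j else 'X_l) | l < n.+2].

Lemma meval_rot_mpoly i j c s f x : (rot_mpoly i j c s f).@[x] = f.@[rot i j c s x].
Proof.
rewrite /rot_mpoly comp_mpoly_meval; apply: meval_eq => l; rewrite tnth_mktuple /rot.
case: ifP => _; last case: ifP => _; rewrite ?(mevalB, mevalD, mevalZ, mevalXU)//.
Qed.

Lemma rot_mpoly_homog i j c s d f :
  f \is d.-homog -> rot_mpoly i j c s f \is d.-homog.
Proof.
move=> /dhomogP fd; rewrite /rot_mpoly comp_mpolyE big_seq; apply: rpred_sum => m mf.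
apply: rpredZ; have -> : d = (\sum_i m i)%N by rewrite -mdegE; apply/esym/fd.
apply: (big_ind2 (fun e g => g \is e.-homog)); first exact: dhomog1.
  by move=> e g e' g'; exact: dhomogM.
move=> l _; apply: exp_homog1; rewrite tnth_mktuple.
by case: ifP => _; last case: ifP => _; rewrite ?(rpredB, rpredD, rpredZ)// var_homog.
Qed.

(** The rotation by the angle of (x_0, x_j) has its whole length in coordinate 0 of [z]; zeros at
    other places survive. *)
Lemma givens (x : 'I_n.+2 -> R) j : j != ord0 -> exists c s z,
  [/\ c ^+ 2 + s ^+ 2 = 1, x =1 rot ord0 j c s z, z j = 0,
     forall l, x l = 0 -> l != ord0 -> z l = 0
   & \sum_l z l ^+ 2 = \sum_l x l ^+ 2].
Proof.
move=> j0; pose r := Num.sqrt (x ord0 ^+ 2 + x j ^+ 2).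
have r2 : r ^+ 2 = x ord0 ^+ 2 + x j ^+ 2 by rewrite sqr_sqrtr// addr_ge0// sqr_ge0.
(* When both coordinates vanish there is no angle, and the identity serves. *)
have [r0|r0] := eqVneq r 0.
  have xj0 : x j = 0.
    apply/eqP; rewrite -sqrf_eq0 eq_le sqr_ge0 andbT.
    by move: r2; rewrite r0 expr0n /= => /eqP; have := sqr_ge0 (x ord0); lra.
  exists 1, 0, x; split=> //; first by rewrite expr1n expr0n addr0.
  by move=> l; rewrite /rot !mul1r !mul0r subr0 add0r; do 2!case: eqP => [->|_] //.
exists (x ord0 / r), (x j / r).
exists (fun l => if l == ord0 then r else if l == j then 0 else x l); split.
- by rewrite !expr_div_n -mulrDl -r2 divff// expf_neq0.
- move=> l; rewrite /rot eqxx (negbTE j0) eqxx !mulr0 subr0 addr0 !divfK//.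
  by do 2!case: eqP => [->|_] //.
- by rewrite (negbTE j0) eqxx.
- by move=> l xl l0; rewrite (negbTE l0); case: eqP.
rewrite !(bigD1 ord0 isT)/= !(bigD1 j j0)/= !eqxx (negbTE j0) r2 expr0n add0r -addrA.
congr (_ + (_ + _)); apply: eq_bigr => l /andP[l0 lj].
by rewrite (negbTE l0) (negbTE lj).
Qed.

(** Induction on the last index where [x] may be nonzero: a plane rotation moves that coordinate
    into coordinate 0, until [x] is a multiple of the pole. *)
Lemma sphere_bound f x : f \is k.*2.-homog -> (forall x, 0 <= f.@[x]) ->
  f.@[x] <= dimk * (\sum_l x l ^+ 2) ^+ k * I f.
Proof.
move=> fh f0.
have H m : forall f x, f \is k.*2.-homog -> (forall x, 0 <= f.@[x]) ->
    (forall l : 'I_n.+2, (m < l)%N -> x l = 0) ->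
    f.@[x] <= dimk * (\sum_l x l ^+ 2) ^+ k * I f.
  elim: m => [|m IH] {x fh f0}f x fh f0 xm.
    rewrite (meval_eq (v2 := fun l => x ord0 * (l == ord0)%:R)); last first.
      move=> l; case: eqP => [->|l0]; first by rewrite mulr1.
      by rewrite mulr0 xm// lt0n; apply/eqP => e; apply: l0; exact/val_inj.
    rewrite (meval_homog _ _ fh) big_ord_recl big1 ?addr0; last first.
      by move=> l _; rewrite xm// expr0n.
    rewrite -exprM mul2n mulrC -mulrA [_ * I f]mulrC mulrA.
    by apply: ler_wpM2r (pole_bound fh f0); rewrite -mul2n exprM exprn_ge0// sqr_ge0.
  case: (ltnP m.+1 n.+2) => mn; last first.
    by apply: IH => // l ml; have := ltn_ord l; lia.
  pose j := Ordinal mn.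
  have [|c [s [z [cs xz zj z0 <-]]]] := @givens x j; first by [].
  have j0 : ord0 != j by [].
  rewrite (meval_eq (v2 := rot ord0 j c s z))// -meval_rot_mpoly.
  rewrite -(@I_rot _ _ _ _ _ (rot_mpoly ord0 j c s f) j0 cs); last first.
    by move=> y; rewrite meval_rot_mpoly.
  apply: IH; first exact: rot_mpoly_homog.
    by move=> y; rewrite meval_rot_mpoly.
  move=> l; rewrite leq_eqVlt => /orP[/eqP ml|ml].
    by rewrite (_ : l = j)//; apply/val_inj; rewrite /= ml.
  by apply: z0; [exact: xm|apply/eqP => l0; rewrite l0 in ml].
by apply: (H n.+2) => // l; have := ltn_ord l; lia.
Qed.

(** The form |x|^k C_k^(lam)(x_0 / |x|). *)
Definition zonal : P :=
  \sum_(j < k.+1) gcoef lam k j *: (X0 ^+ (k - j.*2) * rsq ^+ j).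

Lemma zonal_homog : zonal \is k.-homog.
Proof.
apply: rpred_sum => j _; rewrite /gcoef; case: ifP => jk; last by rewrite scale0r rpred0.
apply: rpredZ; have kE : (k - j.*2 + 2 * j)%N = k by lia.
rewrite -[X in is_true (_ \is X.-homog)]kE.
apply: dhomogM; first by apply: exp_homog1; exact: var_homog.
apply: dhomogMn; apply: rpred_sum => i _; apply: exp_homog1; exact: var_homog.
Qed.

Lemma meval_zonal : zonal.@[fun l => (l == ord0)%:R] = dimk.
Proof.
rewrite -sum_gcoef rmorph_sum/=; apply: eq_bigr => j _.
rewrite mevalZ mevalM !rmorphXn/= mevalXU eqxx expr1n mul1r.
rewrite rmorph_sum/= big_ord_recl big1 ?addr0 => [|i _]; rewrite rmorphXn/= mevalXU.
  by rewrite eqxx !expr1n mulr1.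
by rewrite lift_eqF expr0n.
Qed.

(** By [gsum_moment] each monomial x_0^(k-2i) |x|^(2i) of one factor has mean 1 against the other,
    leaving the sum of the coefficients. *)
Lemma I_zonal_sqr : I (zonal ^+ 2) = dimk.
Proof.
rewrite expr2 {1}/zonal mulr_suml Isum -sum_gcoef; apply: eq_bigr => i _.
have [ik|ik] := leqP i.*2 k; last first.
  by rewrite /gcoef leqNgt ik /= scale0r mul0r I0.
rewrite -scalerAl IZ -[RHS]mulr1; congr (_ * _).
rewrite -(@gsum_moment R lam k (k - i)) ?lam_gt0//; try lia.
rewrite /zonal mulr_sumr Isum; apply: eq_bigr => j _.
rewrite -scalerAr IZ /gcoef; case: ifP => jk; last by rewrite !mul0r.
congr (_ * _); rewrite -I_X0 mulrACA -!exprD [X0 ^+ _ * _]mulrC.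
have -> : (k - i.*2 + (k - j.*2) = (k - i - j).*2)%N by lia.
by elim: (i + j)%N => [|m IH]; rewrite ?expr0 ?mul1r// exprS -mulrA I_rsq.
Qed.

Lemma extremal_form : exists f : P,
  [/\ f \is k.*2.-homog, forall x, 0 <= f.@[x], I f = 1
    & f.@[fun l => (l == ord0)%:R] = dimk].
Proof.
have d0 := dimk_gt0; have dn : dimk != 0 by rewrite lt0r_neq0.
exists (dimk^-1 *: zonal ^+ 2); split.
- by apply: rpredZ; rewrite -muln2; apply: dhomogMn; exact: zonal_homog.
- by move=> x; rewrite mevalZ rmorphXn/= mulr_ge0 ?sqr_ge0// invr_ge0 ltW.
- by rewrite IZ I_zonal_sqr mulVf.
- by rewrite mevalZ rmorphXn/= meval_zonal expr2 mulKf.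
Qed.

End Dehomogenized.

End Mean.
End SphericalMean.

(** * Iterated integrals *)

Module IteratedIntegral.
Set Implicit Arguments.
Unset Strict Implicit.
Unset Printing Implicit Defensive.
Import all_classical all_reals all_analysis measurable_realfun.
Import Order.TTheory GRing.Theory Num.Theory.
Import numFieldNormedType.Exports.
Local Open Scope ring_scope.
Local Open Scope classical_set_scope.

Lemma bounded_support_integrable d (T : measurableType d) (R : realType)
    (mu : {measure set T -> \bar R}) (A : set T) (f : T -> R) (B : R) :
  measurable A -> (mu A < +oo)%E -> measurable_fun setT f ->
  (forall x, `|f x| <= B) -> (forall x, ~ A x -> f x = 0) ->
  mu.-integrable setT (EFin \o f).
Proof.
move=> mA muA mf fB f0.
have -> : EFin \o f = (EFin \o f) \_ A.
  apply/funext => x; rewrite patchE; case: ifPn => //= /negP; rewrite inE => /f0 ->.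
  by [].
apply/(integrable_mkcond _ mA).1/measurable_bounded_integrable => //.
- exact: measurable_funTS.
- exists B; split; first exact: num_real.
  by move=> M BM x _ /=; apply: le_trans (fB x) (ltW BM).
Qed.

Section I.
Variable R : realType.
Local Notation leb := (@lebesgue_measure R).
Implicit Types (g h : (nat -> R) -> R) (w : nat -> R) (s : seq nat).

(** * Coordinatewise integration and Fubini *)

Definition upd (i : nat) (t : R) w : nat -> R := fun l => if l == i then t else w l.

(** The result is again a function of all coordinates, so that integrations in different coordinates
    can be composed in any order. *)
Definition cint (i : nat) g : (nat -> R) -> R :=
  fun w => Rintegral leb setT (fun t => g (upd i t w)).

Lemma cint_ext i g w (f : R -> R) : (forall t, g (upd i t w) = f t) ->
  cint i g w = Rintegral leb setT f.
Proof. by move=> gf; apply: eq_Rintegral => t _; exact: gf. Qed.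

Lemma updC i j t u w : i != j -> upd i t (upd j u w) = upd j u (upd i t w).
Proof.
move=> ij; apply/funext => l; rewrite /upd.
by case: (l =P i) => [->|//]; rewrite (negbTE ij).
Qed.

Lemma foldr_cint_upd i t s g w : i \notin s ->
  foldr cint (fun v => g (upd i t v)) s w = foldr cint g s (upd i t w).
Proof.
elim: s w => [//|j s IH] w; rewrite inE negb_or => /andP[ij is_] /=.
by apply: eq_Rintegral => u _; rewrite IH// updC// eq_sym.
Qed.

(** The list is reversed because the outermost integral is over the last coordinate. *)
Lemma iter_intE m g : iter_int m g = foldr cint g (rev (iota 0 m)) (fun=> 0).
Proof.
elim: m g => [//|m IH] g.
rewrite -[in RHS]addn1 iotaD rev_cat /= add0n; apply: eq_Rintegral => t _.
by rewrite IH foldr_cint_upd// mem_rev mem_iota add0n ltnn andbF.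
Qed.

(* Measurability tested on measurable families of coordinates, which avoids a
   sigma-algebra on [nat -> R]. *)
Definition coord_measurable g := forall d (T : measurableType d) (c : nat -> T -> R),
  (forall i, measurable_fun setT (c i)) ->
  measurable_fun setT (fun x => g (fun i => c i x)).

(** Enough for Fubini, and stable under integration: the support is bounded only in the coordinates
    [s] still to be integrated. *)
Definition tame s g := [/\ coord_measurable g, exists B : R, forall w, `|g w| <= B
  & exists r : R, forall i w, i \in s -> r < `|w i| -> g w = 0].

Lemma measurable_upd d (T : measurableType d) (c : nat -> T -> R) (u : T -> R) i :
  (forall l, measurable_fun setT (c l)) -> measurable_fun setT u ->
  forall l, measurable_fun setT (fun x => upd i (u x) (fun j => c j x) l).
Proof. by move=> mc mu l; rewrite /upd; case: eqP. Qed.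

Lemma tame_integrable s g i w : tame s g -> i \in s ->
  leb.-integrable setT (EFin \o (fun t => g (upd i t w))).
Proof.
move=> [mg [B gB] [r gr]] is_.
have := @bounded_support_integrable _ _ R leb `[- r, r]%classic (fun t => g (upd i t w)) B.
apply => //.
- by rewrite /= lebesgue_measure_itv; case: ifP => _; rewrite ?ltry// -EFinB ltry.
- by apply: (mg _ _ (fun l t => upd i t w l)) => l; apply: measurable_upd.
- move=> t; rewrite /= in_itv /= => /negP; rewrite -ler_norml -ltNge => rt.
  by apply: (gr i) => //; rewrite /upd eqxx.
Qed.

(** Tonelli for the positive and the negative part. *)
Lemma coord_measurable_cint i g : coord_measurable g -> coord_measurable (cint i g).
Proof.
move=> mg d T c mc.
pose F (p : T * R) := g (upd i p.2 (fun l => c l p.1)).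
have mF : measurable_fun [set: T * R] F.
  apply: (mg _ (T * R)%type (fun l p => upd i p.2 (fun l => c l p.1) l)) => l.
  apply: (@measurable_upd _ (T * R)%type (fun l p => c l p.1)) => [j|].
    exact: measurableT_comp (mc j) measurable_fst.
  exact: measurable_snd.
have -> : (fun x => cint i g (fun l => c l x)) = fine \o (fun x =>
    (\int[leb]_t (EFin \o F)^\+ (x, t) - \int[leb]_t (EFin \o F)^\- (x, t))%E).
  apply/funext => x; rewrite /cint /Rintegral /= [in LHS]integralE.
  by congr (fine (_ - _)%E); apply: eq_integral => t _; rewrite ?funeposE ?funenegE.
apply: (@measurableT_comp _ _ _ _ _ _ fine) => //.
apply: emeasurable_funB.
- apply: (@measurable_fun_fubini_tonelli_F _ _ _ _ R leb ((EFin \o F)^\+)%E) => //.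
  by apply: measurable_funepos; exact/measurable_EFinP.
- apply: (@measurable_fun_fubini_tonelli_F _ _ _ _ R leb ((EFin \o F)^\-)%E) => //.
  by apply: measurable_funeneg; exact/measurable_EFinP.
Qed.

Lemma tame_subset s s' g : {subset s' <= s} -> tame s g -> tame s' g.
Proof.
move=> ss' [mg bg [r gr]]; split=> //; exists r => i w /ss'; exact: gr.
Qed.

Lemma tame_cint i s g : tame (i :: s) g -> i \notin s -> tame s (cint i g).
Proof.
move=> tg is_; have [mg [B gB] [r gr]] := tg; split.
- exact: coord_measurable_cint.
- exists (B * fine (leb `[- r, r]%classic)) => w.
  have it : leb.-integrable setT (EFin \o (fun t => g (upd i t w))).
    by apply: tame_integrable tg _; rewrite mem_head.
  apply: le_trans (le_normr_Rintegral measurableT it) _.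
  have -> : (\int[leb]_t `|g (upd i t w)| = \int[leb]_(t in `[- r, r]) `|g (upd i t w)|)%R.
    rewrite [RHS]Rintegral_mkcond; congr (Rintegral _ _ _); apply/funext => t.
    rewrite patchE; case: ifPn => //; rewrite notin_setE /= in_itv /= => /negP.
    rewrite -ler_norml -ltNge => rt.
    by rewrite (gr i) ?mem_head ?normr0// /upd eqxx.
  rewrite -Rintegral_cst//; apply: le_Rintegral => //.
  + have := integrable_norm it; rewrite (_ : _ \o _ = EFin \o (fun t => `|g (upd i t w)|))//.
    by apply: integrableS.
  + apply/integrableP; split; first exact/measurable_EFinP/measurable_cst.
    rewrite integral_cst//= lebesgue_measure_itv /=.
    by case: ifP => _; rewrite ?mule0 ?ltry// -EFinB -EFinM ltry.
- exists r => j w js rj.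
  have -> : cint i g w = (\int[leb]_(t in setT) 0)%R.
    apply: eq_Rintegral => t _; apply: (gr j); first by rewrite inE js orbT.
    by rewrite /upd; case: eqP => [ji|//]; rewrite -ji js in is_.
  by rewrite Rintegral_cst// mul0r.
Qed.

Lemma cint_linear a i s g h : tame s g -> tame s h -> i \in s ->
  cint i (fun v => a * g v + h v) = (fun v => a * cint i g v + cint i h v).
Proof.
move=> tg th is_; apply/funext => w; rewrite /cint RintegralD//.
- by rewrite RintegralZl//; exact: tame_integrable tg is_.
- have := integrableZl measurableT a (tame_integrable w tg is_).
  by apply: eq_integrable.
- exact: tame_integrable th is_.
Qed.

Lemma cint_le i s g h : tame s g -> tame s h -> i \in s ->
  (forall w, g w <= h w) -> forall w, cint i g w <= cint i h w.
Proof.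
move=> tg th is_ gh w; apply: le_Rintegral => //; exact: tame_integrable is_.
Qed.

Lemma cint_ge0 i g : (forall w, 0 <= g w) -> forall w, 0 <= cint i g w.
Proof. by move=> g0 w; apply: Rintegral_ge0 => t _. Qed.

(** Fubini on the plane, where the integrand is bounded and supported in a square. *)
Lemma cintC i j s g : tame s g -> i \in s -> j \in s -> i != j ->
  cint i (cint j g) = cint j (cint i g).
Proof.
move=> tg is_ js ij; have [mg [B gB] [r gr]] := tg; apply/funext => w.
pose F (p : R * R) := g (upd i p.1 (upd j p.2 w)).
have mF : measurable_fun [set: R * R] F.
  apply: (mg _ (R * R)%type (fun l p => upd i p.1 (upd j p.2 w) l)) => l.
  apply: (@measurable_upd _ (R * R)%type (fun l p => upd j p.2 w l)) => [l'|].
    by apply: (@measurable_upd _ (R * R)%type (fun l p => w l)).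
  exact: measurable_fst.
have iF : (leb \x leb)%E.-integrable setT (EFin \o F).
  pose I := (`[- r, r]%classic : set R).
  have Ifin : (leb I < +oo)%E.
    by rewrite lebesgue_measure_itv /=; case: ifP => _; rewrite ?ltry// -EFinB ltry.
  have := @bounded_support_integrable _ _ R (leb \x leb)%E (I `*` I) F B.
  apply => //.
  - by apply: measurableX; exact: measurable_itv.
  - have E : ((leb \x leb) (I `*` I) = leb I * leb I)%E.
      by apply: product_measure1E; exact: measurable_itv.
    have : (leb I * leb I < +oo)%E by rewrite lte_mul_pinfty// ge0_fin_numE.
    by rewrite -E.
  - by move=> p; exact: gB.
  - move=> [t u] /= /not_andP[]; rewrite /I /= in_itv /= => /negP; rewrite -ler_norml -ltNge => ru.
      by apply: (gr i) => //; rewrite /upd eqxx.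
    by apply: (gr j) => //; rewrite /F updC// /upd eqxx.
have fin_inner i' w' : i' \in s ->
    (\int[leb]_t (g (upd i' t w'))%:E = (cint i' g w')%:E)%E.
  move=> i's; rewrite /cint /Rintegral fineK//.
  exact: integrable_fin_num (tame_integrable w' tg i's).
transitivity (fine (\int[leb]_t \int[leb]_u (EFin \o F) (t, u))).
  rewrite [LHS]/cint /Rintegral; congr fine; apply: eq_integral => t _.
  by rewrite -fin_inner//; apply: eq_integral => u _; rewrite /= /F [in RHS]updC.
rewrite Fubini// [RHS]/cint /Rintegral; congr fine; apply: eq_integral => t _.
by rewrite -fin_inner.
Qed.

Lemma tame_foldr s s' g : uniq (s ++ s') -> tame (s ++ s') g ->
  tame s' (foldr cint g s).
Proof.
elim: s s' => [//|j s IH] s' /= /andP[js us] tg.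
apply: (@tame_cint j); last by move: js; rewrite mem_cat negb_or => /andP[].
apply: IH; first by rewrite (uniq_catCA s [:: j] s') /= js.
by apply: tame_subset tg => a; rewrite !(mem_cat, inE) orbCA.
Qed.

Lemma cint_foldr i s g : uniq (i :: s) -> tame (i :: s) g ->
  cint i (foldr cint g s) = foldr cint (cint i g) s.
Proof.
elim: s => [//|j s IH] uijs tg.
have [ij uijs'] : i != j /\ uniq (s ++ [:: i; j]).
  split; first by move: uijs; rewrite /= inE negb_or => /andP[/andP[]].
  by rewrite uniq_catC.
have tg' : tame (s ++ [:: i; j]) g.
  apply: tame_subset tg => a.
  by rewrite mem_cat !inE => /orP[->|/orP[->|->]]; rewrite ?orbT.
rewrite /= (cintC (tame_foldr uijs' tg'))// ?inE ?eqxx ?orbT// IH//.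
- by move: uijs; rewrite /= inE negb_or => /andP[/andP[_ ->] /andP[_ ->]].
- by apply: tame_subset tg => a; rewrite !inE => /orP[->|->]; rewrite ?orbT.
Qed.

(** Makes coordinate [i] innermost, ready for a change of variable in it alone. *)
Lemma foldr_cint_rem i s g : i \in s -> uniq s -> tame s g ->
  foldr cint g s = foldr cint (cint i g) (rem i s).
Proof.
elim: s => [//|j s IH]; rewrite inE /= => + /andP[js us] tg.
have [-> _|ij /= is_] := eqVneq i j.
  by rewrite cint_foldr//= js.
rewrite IH//; apply: tame_subset tg => a.
by rewrite inE => ->; rewrite orbT.
Qed.

(** * Invariance under translations, shears and plane rotations *)

Definition translate (a t : measurableTypeR R) : measurableTypeR R := t + a.

Lemma measurable_translate a : measurable_fun setT (translate a).
Proof. by apply: measurable_funD => //; exact: measurable_cst. Qed.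

HB.instance Definition _ a :=
  isMeasurableFun.Build _ _ _ _ (translate a) (measurable_translate a).

Lemma lebesgue_measure_translate a (A : set R) : measurable A ->
  pushforward leb (translate a) A = leb A.
Proof.
move=> mA; apply/esym/lebesgue_measure_unique => //= _ [[x y]] _ <-.
rewrite /pushforward (_ : translate a @^-1` _ = `]x - a, y - a]%classic).
  rewrite !lebesgue_measure_itv/= !lte_fin ltrD2r.
  by case: ifP => // _; rewrite -!EFinB opprB addrA subrK.
by apply/seteqP; split => t /=; rewrite !in_itv/= ltrBlDr lerBrDr.
Qed.

Lemma Rintegral_translate (f : R -> R) a :
  measurable_fun setT f -> leb.-integrable setT (EFin \o f) ->
  leb.-integrable setT (EFin \o (fun t => f (t + a))) ->
  Rintegral leb setT (fun t => f (t + a)) = Rintegral leb setT f.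
Proof.
move=> mf itf ita; rewrite /Rintegral; congr fine.
rewrite -(@integral_pushforward _ _ _ _ R (translate a) (measurable_translate a) leb setT
  (EFin \o f)) //; first last.
- exact/measurable_EFinP.
by apply: eq_measure_integral => A mA _; exact: lebesgue_measure_translate.
Qed.

Definition shear i j a w := upd i (w i + a * w j) w.

Lemma tame_shear i j a s g : i != j -> i \in s -> j \in s -> tame s g ->
  tame s (fun w => g (shear i j a w)).
Proof.
move=> ij is_ js [mg [B gB] [r gr]]; split.
- move=> d T c mc; apply: (mg _ _ (fun l x => shear i j a (fun l => c l x) l)).
  apply: measurable_upd => //; apply: measurable_funD => //.
  by apply: measurable_funM => //; exact: measurable_cst.
- by exists B => w.
(* If |w_j| <= |r|, the shear moves w_i by at most |a| |r|, so w_i still ends beyond |r|. *)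
exists (`|r| + `|a| * `|r|) => l w ls rl.
have rr : r <= `|r| := ler_norm r.
have ar : 0 <= `|a| * `|r| by rewrite mulr_ge0.
have [li|li] := eqVneq l i; last first.
  apply: (gr l) => //; rewrite /shear /upd (negbTE li); lra.
have [wj|wj] := leP `|w j| `|r|; last first.
  by apply: (gr j) => //; rewrite /shear /upd eq_sym (negbTE ij); lra.
apply: (gr i) => //; rewrite /shear /upd eqxx.
have := ler_normB (w i + a * w j) (a * w j); rewrite addrK normrM -li => h.
have : `|a| * `|w j| <= `|a| * `|r| by rewrite ler_wpM2l.
by lra.
Qed.

(** With the other coordinates fixed, a shear is a translation in coordinate [i]. *)
Lemma cint_shear i j a s g : i != j -> i \in s -> j \in s -> tame s g ->
  cint i (fun w => g (shear i j a w)) = cint i g.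
Proof.
move=> ij is_ js tg; have [mg _ _] := tg; apply/funext => w; rewrite /cint.
have E t : shear i j a (upd i t w) = upd i (t + a * w j) w.
  apply/funext => l; rewrite /shear /upd eqxx [j == i]eq_sym (negbTE ij).
  by case: eqP.
rewrite (_ : (fun t => _) = fun t => g (upd i (t + a * w j) w)); last first.
  by apply/funext => t; rewrite E.
apply: (@Rintegral_translate (fun t => g (upd i t w))).
- by apply: (mg _ _ (fun l t => upd i t w l)) => l; apply: measurable_upd.
- exact: tame_integrable tg is_.
- have := tame_integrable w (tame_shear a ij is_ js tg) is_.
  by apply: eq_integrable => // t _; rewrite /= E.
Qed.

Lemma foldr_cint_shear i j a s g : i != j -> i \in s -> j \in s -> uniq s -> tame s g ->
  foldr cint (fun w => g (shear i j a w)) s = foldr cint g s.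
Proof.
move=> ij is_ js us tg; have ts := tame_shear a ij is_ js tg.
by rewrite (foldr_cint_rem is_ us ts) (foldr_cint_rem is_ us tg) (cint_shear a ij is_ js tg).
Qed.

Definition rotw (i j : nat) (c s' : R) w :=
  upd i (c * w i - s' * w j) (upd j (s' * w i + c * w j) w).

(* A rotation is a product of three shears (the half turn being the square of a
   quarter turn). *)
Lemma foldr_cint_rot (i j : nat) (c s' : R) s g : i != j -> c ^+ 2 + s' ^+ 2 = 1 ->
  i \in s -> j \in s -> uniq s -> tame s g ->
  foldr cint (fun w => g (rotw i j c s' w)) s = foldr cint g s /\
  tame s (fun w => g (rotw i j c s' w)).
Proof.
move=> + + is_ js us; have main (c' s1 : R) f : i != j -> c' ^+ 2 + s1 ^+ 2 = 1 -> 1 + c' != 0 ->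
    tame s f -> foldr cint (fun w => f (rotw i j c' s1 w)) s = foldr cint f s /\
    tame s (fun w => f (rotw i j c' s1 w)).
  move=> ij cs c1 tf; have ji : j != i by rewrite eq_sym.
  (* The tangent of half the angle. *)
  pose k := s1 / (1 + c').
  have E w : rotw i j c' s1 w = shear i j (- k) (shear j i s1 (shear i j (- k) w)).
    have ks : s1 * k = 1 - c'.
      by rewrite /k mulrA -expr2 (_ : s1 ^+ 2 = (1 - c') * (1 + c')) ?mulfK//; lra.
    have kc : k * (1 + c') = s1 by rewrite /k divfK.
    apply/funext => l; rewrite /rotw /shear /upd !eqxx (negbTE ij) (negbTE ji).
    have e1 : w i * (s1 * k) = w i * (1 - c') by rewrite ks.
    have e2 : w j * (k * (s1 * k)) = w j * (k * (1 - c')) by rewrite ks.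
    have e3 : w j * (k * (1 + c')) = w j * s1 by rewrite kc.
    have e4 : w j * (s1 * k) = w j * (1 - c') by rewrite ks.
    by case: eqP => // _; [|case: eqP => // _]; lra.
  have t1 := tame_shear (- k) ij is_ js tf.
  have t2 := tame_shear s1 ji js is_ t1.
  have t3 := tame_shear (- k) ij is_ js t2.
  rewrite (_ : (fun w => f (rotw i j c' s1 w)) =
    (fun w => f (shear i j (- k) (shear j i s1 (shear i j (- k) w))))); last first.
    by apply/funext => w; rewrite E.
  split=> //; rewrite (foldr_cint_shear _ ij is_ js us t2).
  by rewrite (foldr_cint_shear _ ji js is_ us t1) (foldr_cint_shear _ ij is_ js us tf).
move=> ij cs tg; have [c1|c1] := eqVneq (1 + c) 0; last exact: main.
have q1 : (0 : R) ^+ 2 + 1 ^+ 2 = 1 by rewrite expr0n expr1n add0r.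
have q2 : 1 + 0 != 0 :> R by rewrite addr0 oner_eq0.
have [e1 t1] := main 0 1 g ij q1 q2 tg; have [e2 t2] := main 0 1 _ ij q1 q2 t1.
have cE : c = -1 by lra.
have s0 : s' = 0 by apply/eqP; rewrite -sqrf_eq0; apply/eqP; move: cs; rewrite cE; lra.
rewrite (_ : (fun w => g (rotw i j c s' w)) =
  (fun w => g (rotw i j 0 1 (rotw i j 0 1 w)))); first by rewrite e2 e1.
apply/funext => w; congr g; apply/funext => l.
have ji : j != i by rewrite eq_sym.
rewrite cE s0 /rotw /upd !eqxx ?(negbTE ij) ?(negbTE ji).
by case: eqP => _; [lra|case: eqP => // _; lra].
Qed.

Lemma foldr_cint_linear a s g h : uniq s -> tame s g -> tame s h ->
  foldr cint (fun v => a * g v + h v) s =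
  (fun w => a * foldr cint g s w + foldr cint h s w).
Proof.
elim: s => [//|i s IH] /= /andP[is_ us] tg th.
have ts f : tame (i :: s) f -> tame s f.
  by apply: tame_subset => l ls; rewrite inE ls orbT.
have tf f : tame (i :: s) f -> tame [:: i] (foldr cint f s).
  move=> tif; apply: tame_foldr; first by rewrite uniq_catC /= is_ us.
  by apply: tame_subset tif => l; rewrite mem_cat !inE orbC.
by rewrite (IH us (ts _ tg) (ts _ th)) (cint_linear a (tf _ tg) (tf _ th)) ?mem_head.
Qed.

Lemma foldr_cint_ge0 s g : (forall w, 0 <= g w) -> forall w, 0 <= foldr cint g s w.
Proof. by move=> g0; elim: s => [//|i s IH] /=; exact: cint_ge0. Qed.

Lemma foldr_cint_le s g h : uniq s -> tame s g -> tame s h ->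
  (forall w, g w <= h w) -> forall w, foldr cint g s w <= foldr cint h s w.
Proof.
elim: s => [//|i s IH] /= /andP[is_ us] tg th gh.
have ts f : tame (i :: s) f -> tame s f.
  by apply: tame_subset => l ls; rewrite inE ls orbT.
have tf f : tame (i :: s) f -> tame [:: i] (foldr cint f s).
  move=> tif; apply: tame_foldr; first by rewrite uniq_catC /= is_ us.
  by apply: tame_subset tif => l; rewrite mem_cat !inE orbC.
apply: (cint_le (tf _ tg) (tf _ th) (mem_head _ _)).
by apply: IH => //; exact: ts.
Qed.

Lemma measurable_if_le d (T : measurableType d) (f g h : T -> R) (a : R) :
  measurable_fun setT f -> measurable_fun setT g -> measurable_fun setT h ->
  measurable_fun setT (fun x => if f x <= a then g x else h x).
Proof.
move=> mf mg mh; apply: measurable_fun_ifT => //.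
by apply: measurable_fun_ler => //; exact: measurable_cst.
Qed.

(** Indicator of a cube, a minorant for the ball that shows its volume to be positive. *)
Definition box (b : R) s : (nat -> R) -> R :=
  fun w => if all (fun i => `|w i| <= b) s then 1 else 0.

Lemma box_cons b i s w : box b (i :: s) w = if `|w i| <= b then box b s w else 0.
Proof. by rewrite /box /=; case: leP. Qed.

Lemma tame_box b s : tame s (box b s).
Proof.
split.
- elim: s => [|i s IH] d T c mc; first exact: measurable_cst.
  rewrite (_ : (fun x => _) = fun x => if `|c i x| <= b then box b s (fun l => c l x) else 0).
    apply: measurable_if_le; [|exact: IH|exact: measurable_cst].
    by apply: measurableT_comp => //.
  by apply/funext => x; rewrite box_cons.
- by exists 1 => w; rewrite /box; case: ifP; rewrite ?normr1 ?normr0.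
- exists b => i w is_ bw; rewrite /box; case: ifPn => // /allP /(_ _ is_).
  by rewrite leNgt bw.
Qed.

Lemma cint_box b i s : 0 <= b -> i \notin s ->
  cint i (box b (i :: s)) = (fun w => b *+ 2 * box b s w).
Proof.
move=> b0 is_; apply/funext => w.
have E t : box b (i :: s) (upd i t w) = ((fun=> box b s w) \_ `[- b, b]%classic) t.
  rewrite box_cons patchE mem_setE in_itv /= -ler_norml /upd eqxx; case: ifP => // _.
  rewrite /box; congr (if _ then _ else _); apply: eq_in_all => l ls.
  by case: eqP => // li; rewrite -li ls in is_.
have F : fine (leb `[- b, b]%classic) = b *+ 2.
  rewrite lebesgue_measure_itv /= lte_fin; case: ltP => bb.
    by rewrite -EFinB/= opprK mulr2n.
  by have -> : b = 0 by [lra]; rewrite mul0rn.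
rewrite (cint_ext E) -Rintegral_mkcond Rintegral_cst// [RHS]mulrC; congr (_ * _).
exact: F.
Qed.

Lemma foldr_cint_box b s w : 0 <= b -> uniq s -> foldr cint (box b s) s w = (b *+ 2) ^+ size s.
Proof.
move=> b0; elim: s w => [//|i s IH] w us.
have /andP[is_ us'] : (i \notin s) && uniq s by [].
rewrite /= (cint_foldr us (tame_box _ _)) cint_box//.
have z : tame s (fun=> 0).
  split; last by exists 0.
    by move=> d T c _; exact: measurable_cst.
  by exists 0 => v; rewrite normr0.
have := foldr_cint_linear (b *+ 2) us' (tame_box b s) z.
rewrite (_ : (fun v => _ + 0) = (fun v => b *+ 2 * box b s v)); last first.
  by apply/funext => v; rewrite addr0.
move=> ->; rewrite IH// exprS (_ : foldr cint (fun=> 0) s w = 0) ?addr0//.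
elim: (s) w => [//|l s' IH'] w /=.
by rewrite (cint_ext (fun t => IH' (upd l t w))) Rintegral_cst// mul0r.
Qed.

End I.
End IteratedIntegral.

(** * The cone measure on the sphere *)

Module SphereMean.
Set Implicit Arguments.
Unset Strict Implicit.
Unset Printing Implicit Defensive.
Import all_classical all_reals all_analysis measurable_realfun.
Import Order.TTheory GRing.Theory Num.Theory.
Import numFieldNormedType.Exports.
Import IteratedIntegral.
Local Open Scope ring_scope.
Local Open Scope classical_set_scope.

Section S.
Variables (R : realType) (n : nat).
Implicit Types (g h : ('I_n.+1 -> R) -> R) (v : nat -> R) (x : 'I_n.+1 -> R).
Local Notation coords := (rev (iota 0 n.+1)).

Let uniq_coords : uniq coords.
Proof. by rewrite rev_uniq iota_uniq. Qed.

Let mem_coords (i : 'I_n.+1) : (i : nat) \in coords.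
Proof. by rewrite mem_rev mem_iota /= add0n. Qed.

Definition sphere_fun g v : R :=
  if enorm n.+1 v <= 1 then g (fun i => v i / enorm n.+1 v) else 0.

(** The bound is asked on the cube only, since polynomials are unbounded; the points v / |v| lie
    there. *)
Definition sphere_admissible g :=
  (forall d (T : measurableType d) (c : 'I_n.+1 -> T -> R),
     (forall i, measurable_fun setT (c i)) -> measurable_fun setT (fun t => g (fun i => c i t)))
  /\ exists B : R, forall x, (forall i, `|x i| <= 1) -> `|g x| <= B.

Lemma enorm_ge0 v : 0 <= enorm n.+1 v.
Proof. exact: sqrtr_ge0. Qed.

Lemma sqr_enorm v : enorm n.+1 v ^+ 2 = \sum_(i < n.+1) v i ^+ 2.
Proof. by rewrite sqr_sqrtr// sumr_ge0// => i _; exact: sqr_ge0. Qed.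

Lemma le_coord_enorm v (i : 'I_n.+1) : `|v i| <= enorm n.+1 v.
Proof.
rewrite -(@ler_pXn2r _ 2)// ?nnegrE ?enorm_ge0// sqr_enorm real_normK ?num_real//.
by rewrite (bigD1 i)//= lerDl sumr_ge0// => j _; exact: sqr_ge0.
Qed.

Lemma measurable_enorm d (T : measurableType d) (c : nat -> T -> R) :
  (forall i, measurable_fun setT (c i)) ->
  measurable_fun setT (fun t => enorm n.+1 (fun i => c i t)).
Proof.
move=> mc; rewrite (_ : (fun t => _) = fun t => (\sum_(i < n.+1) c i t ^+ 2) `^ 2^-1).
  apply: (@measurableT_comp _ _ _ _ _ _ (@powR R ^~ 2^-1)); first exact: measurable_powR.
  by apply: measurable_sum => i; exact: measurable_funX.
by apply/funext => t; rewrite powR12_sqrt// sumr_ge0// => i _; exact: sqr_ge0.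
Qed.

Lemma tame_sphere_fun g : sphere_admissible g -> tame coords (sphere_fun g).
Proof.
move=> [mg [B gB]]; split.
- move=> d T c mc; apply: measurable_if_le; last exact: measurable_cst.
    exact: measurable_enorm.
  apply: (mg _ _ (fun (i : 'I_n.+1) t => c i t / enorm n.+1 (fun l => c l t))) => i.
  apply: measurable_funM => //.
  rewrite (_ : (fun t => _) = fun t => enorm n.+1 (fun l => c l t) `^ (-1)).
    apply: (@measurableT_comp _ _ _ _ _ _ (@powR R ^~ (-1))); first exact: measurable_powR.
    exact: measurable_enorm.
  by apply/funext => t; rewrite powR_inv1// enorm_ge0.
- exists B => v; have B0 : 0 <= B.
    by apply: le_trans (gB (fun=> 0) _) => // i; rewrite normr0.
  rewrite /sphere_fun; case: ifP => _; last by rewrite normr0.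
  apply: gB => i; rewrite normrM normfV (ger0_norm (enorm_ge0 v)).
  (* Division by zero sends the origin to the origin. *)
  have [->|e0] := eqVneq (enorm n.+1 v) 0; first by rewrite invr0 mulr0.
  by rewrite ler_pdivrMr ?mul1r ?le_coord_enorm// lt_neqAle eq_sym e0 enorm_ge0.
- exists 1 => i v; rewrite mem_rev mem_iota add0n => /= ilt vi.
  rewrite /sphere_fun leNgt (lt_le_trans vi)//.
  exact: (le_coord_enorm v (Ordinal ilt)).
Qed.

Lemma admissible_cst a : sphere_admissible (fun=> a).
Proof. by split; [move=> *; exact: measurable_cst|exists `|a|]. Qed.

Definition ball_int g : R := foldr (@cint R) (sphere_fun g) coords (fun=> 0).

Lemma sphere_intE g : sphere_int g = ball_int g / ball_int (fun=> 1).
Proof. by rewrite /sphere_int !iter_intE. Qed.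

Lemma ball_vol_gt0 : 0 < ball_int (fun=> 1).
Proof.
(* The cube of half-side b = 1/(n+1) lies in the ball: the squared norm is at most (n+1) b^2 <=
   (n+1) b = 1. *)
pose b : R := n.+1%:R^-1; have b0 : 0 < b by rewrite invr_gt0 ltr0n.
apply: (@lt_le_trans _ _ ((b *+ 2) ^+ size coords)).
  by rewrite exprn_gt0// pmulrn_lgt0.
rewrite -(foldr_cint_box (fun=> 0) (ltW b0) uniq_coords).
apply: foldr_cint_le => //; first exact: tame_box.
  exact: tame_sphere_fun (admissible_cst 1).
move=> w; rewrite /box /sphere_fun; case: ifPn => [/allP wb|_]; last by case: ifP.
rewrite ifT// -(@ler_pXn2r _ 2)// ?nnegrE ?enorm_ge0// expr1n sqr_enorm.
apply: (@le_trans _ _ (\sum_(i < n.+1) b)).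
  apply: ler_sum => i _; rewrite -real_normK ?num_real//.
  have wi := wb _ (mem_coords i); have b1 : b <= 1 by rewrite invf_le1 ?ltr0n// ler1n.
  by have := normr_ge0 (w i); nra.
by rewrite sumr_const card_ord -mulr_natr mulVf// pnatr_eq0.
Qed.

Lemma sphere_int_linear a g h : sphere_admissible g -> sphere_admissible h ->
  sphere_int (fun x => a * g x + h x) = a * sphere_int g + sphere_int h.
Proof.
move=> ag ah; rewrite !sphere_intE mulrA -mulrDl; congr (_ / _); rewrite /ball_int.
have -> : sphere_fun (fun x => a * g x + h x) =
    (fun v => a * sphere_fun g v + sphere_fun h v).
  by apply/funext => v; rewrite /sphere_fun; case: ifP => _; rewrite ?mulr0 ?addr0.
by rewrite foldr_cint_linear//; exact: tame_sphere_fun.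
Qed.

Lemma sphere_int_ge0 g : (forall x, 0 <= g x) -> 0 <= sphere_int g.
Proof.
move=> g0; rewrite sphere_intE; apply: divr_ge0; last exact/ltW/ball_vol_gt0.
by apply: foldr_cint_ge0 => w; rewrite /sphere_fun; case: ifP.
Qed.

Lemma sphere_int1 : sphere_int (fun _ : 'I_n.+1 -> R => 1) = 1.
Proof. by rewrite sphere_intE divff// lt0r_neq0 ?ball_vol_gt0. Qed.

(* The integrands may differ only at the origin, where [v / |v|] is a junk value. *)
Lemma eq_sphere_int g h :
  sphere_admissible g -> sphere_admissible h ->
  (forall x, \sum_i x i ^+ 2 = 1 -> g x = h x) -> sphere_int g = sphere_int h.
Proof.
move=> ag ah gh; rewrite !sphere_intE /ball_int; congr (_ / _).
(* In the innermost integral, over coordinate 0, the origin can occur only at t = 0, a null set. *)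
rewrite (_ : iota 0 n.+1 = 0%N :: iota 1 n)// rev_cons -cats1 !foldr_cat /=.
congr (foldr _ _ _ _); apply/funext => w; rewrite /cint /Rintegral; congr fine.
have mf f : sphere_admissible f ->
    measurable_fun setT (fun t : R => (sphere_fun f (upd 0 t w))%:E).
  move=> /tame_sphere_fun[mf _ _]; apply/measurable_EFinP.
  by apply: (mf _ _ (fun l t => upd 0 t w l)) => l; apply: measurable_upd.
have mD : measurable ([set: R] `\ 0) by apply: measurableD.
rewrite -[LHS](@integral_setD1 _ _ 0)//; last exact: measurable_funTS (mf _ ag).
rewrite -[RHS](@integral_setD1 _ _ 0)//; last exact: measurable_funTS (mf _ ah).
apply: eq_integral => t; rewrite inE => -[_ /= t0]; congr (_ %:E).
rewrite /sphere_fun; case: ifP => // _; apply: gh; set v := upd 0 t w.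
have e0 : enorm n.+1 v != 0.
  apply/eqP => e0; apply: t0; apply/eqP; rewrite -normr_eq0 -[t]/(v (@ord0 n)).
  by rewrite eq_le normr_ge0 andbT -e0 le_coord_enorm.
under eq_bigr do rewrite expr_div_n.
by rewrite -mulr_suml -sqr_enorm divff// expf_neq0.
Qed.

Lemma sphere_int_rot (i j : 'I_n.+1) c s g : i != j -> c ^+ 2 + s ^+ 2 = 1 ->
  sphere_admissible g ->
  sphere_int (fun x => g (SphericalMean.rot i j c s x)) = sphere_int g.
Proof.
move=> ij cs ag; rewrite !sphere_intE /ball_int; congr (_ / _).
have [<- _] := foldr_cint_rot ij cs (mem_coords i) (mem_coords j) uniq_coords (tame_sphere_fun ag).
congr (foldr _ _ _ _); apply/funext => v.
have rotE (l : 'I_n.+1) : rotw i j c s v l = SphericalMean.rot i j c s (fun l => v l) l.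
  by [].
rewrite /sphere_fun.
(* Norm invariance makes the rotation commute with v / |v| and preserve the ball. *)
have -> : enorm n.+1 (rotw i j c s v) = enorm n.+1 v.
  congr (Num.sqrt _); under eq_bigr do rewrite rotE.
  have ji : j != i by rewrite eq_sym.
  rewrite (bigD1 i)//= (bigD1 j)//= [RHS](bigD1 i)//= [X in _ = _ + X](bigD1 j)//=.
  rewrite /SphericalMean.rot !eqxx (negbTE ji) !addrA; congr (_ + _).
    by rewrite -[RHS]mul1r -cs; ring.
  by apply: eq_bigr => l /andP[li lj]; rewrite (negbTE li) (negbTE lj).
case: ifP => // _; congr g; apply/funext => l; rewrite rotE /SphericalMean.rot.
by case: ifP => _; last case: ifP => _ //; ring.
Qed.

Lemma admissible_meval (p : poly_n R n.+1) : sphere_admissible (fun x => mpoly.meval x p).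
Proof.
split.
  move=> d T c mc.
  rewrite (_ : (fun t => _) = fun t =>
    \sum_(m <- mpoly.msupp p) mpoly.mcoeff m p * \prod_i c i t ^+ mpoly.fun_of_multinom m i).
    apply: measurable_sum => m; apply: measurable_funM; first exact: measurable_cst.
    by apply: measurable_prod => i _; exact: measurable_funX.
  by apply/funext => t; rewrite mpoly.mevalE.
exists (\sum_(m <- mpoly.msupp p) `|mpoly.mcoeff m p|) => x x1.
rewrite mpoly.mevalE (le_trans (ler_norm_sum _ _ _))// ler_sum// => m _.
rewrite normrM ler_piMr// normr_prod; apply: prodr_ile1 => i _.
by rewrite normrX exprn_ge0//= exprn_ile1.
Qed.

End S.
End SphereMean.

(** * The coefficient of symmetry *)

Module SymmetryCoefficient.
Set Implicit Arguments.
Unset Strict Implicit.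
Unset Printing Implicit Defensive.
Import mpoly boolp reals.
Import Order.TTheory GRing.Theory Num.Theory.
Local Open Scope ring_scope.
Section S.
Variables (R : realType) (n : nat).
Local Notation P := (poly_n R n.+2).

Definition mean (p : P) : R := sphere_int (fun x => ev p x).

Lemma mean_linear (a : R) (p q : P) : mean (a *: p + q) = a * mean p + mean q.
Proof.
rewrite /mean -SphereMean.sphere_int_linear; try exact: SphereMean.admissible_meval.
congr sphere_int; apply/funext => x.
by rewrite /ev /MP.ev mevalD mevalZ.
Qed.

Lemma mean_sub (p q : P) : mean (p - q) = mean p - mean q.
Proof.
by rewrite -[p - q]addrC -scaleN1r mean_linear mulN1r addrC.
Qed.

Lemma mean_ge0 (p : P) : (forall x, 0 <= meval x p) -> 0 <= mean p.
Proof. by move=> p0; apply: SphereMean.sphere_int_ge0. Qed.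

Lemma mean1 : mean 1 = 1.
Proof.
rewrite -[RHS](SphereMean.sphere_int1 R n.+1); congr sphere_int; apply/funext => x.
exact: meval1.
Qed.

(** The factor is 1 on the sphere. *)
Lemma mean_rsq (p : P) : mean (SphericalMean.rsq R n * p) = mean p.
Proof.
apply: SphereMean.eq_sphere_int; try exact: SphereMean.admissible_meval.
move=> x x1; rewrite /ev /MP.ev mevalM (_ : meval x (SphericalMean.rsq R n) = 1).
  by rewrite mul1r.
rewrite -x1 rmorph_sum/=; apply: eq_bigr => i _.
by rewrite rmorphXn/= mevalXU.
Qed.

Lemma mean_rot (i j : 'I_n.+2) (c s : R) (p q : P) : i != j -> c ^+ 2 + s ^+ 2 = 1 ->
  (forall x, meval x q = meval (SphericalMean.rot i j c s x) p) ->
  mean q = mean p.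
Proof.
move=> ij cs pq; rewrite /mean -(SphereMean.sphere_int_rot ij cs (SphereMean.admissible_meval p)).
by congr sphere_int; apply/funext => x; exact: pq.
Qed.

End S.

(** The reflected form r - (f - r)/(D - 1), with r = r^(2k), is nonnegative exactly when f <= D r,
    which is [bound]; the extremal form rules out a larger factor. *)
Lemma symmetry_coefficient (R : realType) (n k : nat) :
  (2 <= n)%N -> (1 <= k)%N ->
  coeff_of_symmetry (@Cbar R n k) (@r2k R n k)
    (('C(n + k - 1, k))%:R - 1)^-1.
Proof.
case: n => [//|[//|n]] _ k1; set D : R := 'C(_, _)%:R.
(* By Pascal's rule [D] is a sum of two positive binomials. *)
have D1 : 0 < D - 1.
  rewrite subr_gt0 ltr1n; have [m kE] : exists m, k = m.+1 by exists k.-1; rewrite prednK.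
  rewrite kE addnS subSS subn0 addSn binS; have := @bin_gt0 (n.+1 + m) m.
  have := @bin_gt0 (n.+1 + m) m.+1; lia.
have bound (f : poly_n R n.+2) x := @SphericalMean.sphere_bound R n (@mean R n)
  (@mean_linear R n) (@mean_ge0 R n) (@mean1 R n) (@mean_rsq R n) (@mean_rot R n) k f x.
have ext := @SphericalMean.extremal_form R n (@mean R n)
  (@mean_linear R n) (@mean1 R n) (@mean_rsq R n) (@mean_rot R n) k.
have ev_r2k x : meval x (@r2k R n.+2 k) = (\sum_l x l ^+ 2) ^+ k.
  rewrite /r2k /MP.r2k rmorphXn rmorph_sum/=; congr (_ ^+ _); apply: eq_bigr => i _.
  by rewrite rmorphXn/= mevalXU.
have mean_r2k : mean (@r2k R n.+2 k) = 1.
  rewrite /r2k /MP.r2k -[RHS](@mean1 R n); elim: (k) => [|m IH]; first by rewrite expr0.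
  by rewrite exprS -[RHS]IH; exact: mean_rsq.
have r2k_form : is_form (2 * k) (@r2k R n.+2 k).
  apply: dhomogMn; apply: rpred_sum => i _.
  apply: (@dhomogMn _ _ _ 1 _ 2); exact: SphericalMean.var_homog.
split.
  move=> f [fh [f0 f1]].
  exists (- (D - 1)^-1 *: (f - r2k R n.+2 k) + r2k R n.+2 k); last by rewrite addrK.
  split; [|split].
  - by apply: rpredD => //; apply: rpredZ; apply: rpredB.
  - move=> x; rewrite /ev /MP.ev mevalD mevalZ mevalB ev_r2k.
    have := bound f x; rewrite -mul2n => /(_ fh f0); rewrite -/D.
    have -> : mean f = 1 by exact: f1.
    set r := (_ ^+ k); rewrite mulr1 => fx.
    rewrite -(pmulr_rge0 _ D1) mulrDr mulrA mulrN mulfV ?lt0r_neq0// mulN1r.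
    by move: fx; rewrite /ev /MP.ev; set y := meval x f; nra.
  - apply: etrans (mean_linear (- (D - 1)^-1) (f - @r2k R n.+2 k) (@r2k R n.+2 k)) _.
    by rewrite mean_r2k mean_sub mean_r2k [mean f]f1 subrr mulr0 add0r.
move=> b' incl; have [f [fh f0 f1 fe]] := ext.
have [|g [_ [g0 _]] gE] := incl f.
  by split; [rewrite /is_form mul2n|split].
pose e0 (l : 'I_n.+2) : R := (l == ord0)%:R.
have r1 : (@r2k R n.+2 k).@[e0] = 1.
  rewrite ev_r2k big_ord_recl big1 ?addr0 => [|i _]; first by rewrite /e0 eqxx !expr1n.
  by rewrite /e0 lift_eqF expr0n.
(* At the pole f = D and r^(2k) = 1, so -b' (D - 1) = g(e_0) - 1 >= -1. *)
have := congr1 (meval e0) gE; rewrite mevalZ !mevalB r1 [f.@[_]]fe -/D => ge.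
have := g0 e0; rewrite /ev /MP.ev => ge0.
by rewrite -[leRHS]div1r ler_pdivlMr// -subr_ge0 -mulNr ge addrC subrK.
Qed.
End SymmetryCoefficient.

From mathcomp Require Import all_classical all_reals all_analysis.
Import Order.TTheory GRing.Theory Num.Theory.
Local Open Scope ring_scope.

Theorem theorem6p8 (R : realType) (n k : nat) :
  (2 <= n)%N -> (1 <= k)%N ->
  coeff_of_symmetry (@Cbar R n k) (@r2k R n k)
    (('C(n + k - 1, k))%:R - 1)^-1.
Proof. exact: SymmetryCoefficient.symmetry_coefficient. Qed.
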